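(* Let $\mathscr{H}$ be a complex Hilbert space, $d,n\ge1$, and let $\mathbb{A}=[\mathbf{A_{ij}}]_{n\times n}$ be an $n\times n$ operator matrix, where $\mathbf{A_{ij}}\in\mathbb{B}^d(\mathscr{H})$, $1\le i,j\le n$. Then for all $\alpha$ with $0\le\alpha\le1$, $$w_e(\mathbb{A})\le w\left([b_{ij}]_{n\times n}\right),$$ where $$b_{ij}=\begin{cases} w_e(\mathbf{A_{ij}}) & \text{when } i=j,\\ w_e^{1/2}\left(|\mathbf{A_{ji}}|^{2\alpha}+|\mathbf{A_{ij}^*}|^{2(1-\alpha)}\right)\,w_e^{1/2}\left(|\mathbf{A_{ij}}|^{2\alpha}+|\mathbf{A_{ji}^*}|^{2(1-\alpha)}\right) & \text{when } i<j,\\ 0 & \text{when } i>j.\end{cases}$$ In particular, $$w_e(\mathbb{A})\le w\left([b'_{ij}]_{n\times n}\right),$$ where $$b'_{ij}=\begin{cases} w_e(\mathbf{A_{ij}}) & \text{when } i=j,\\ \sqrt{w_e\left(|\mathbf{A_{ji}}|+|\mathbf{A_{ij}^*}|\right)\,w_e\left(|\mathbf{A_{ij}}|+|\mathbf{A_{ji}^*}|\right)} & \text{when } i<j,\\ 0 & \text{when } i>j.\end{cases}$$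
   Context: $\mathbb{B}(\mathscr{H})$ is the algebra of bounded linear operators on the complex Hilbert space $\mathscr{H}$, and $\mathbb{B}^d(\mathscr{H})$ is the set of $d$-tuples of such operators. For $T\in\mathbb{B}(\mathscr{H})$, $|T|=(T^*T)^{1/2}$. For a $d$-tuple $\mathbf{T}=(T_1,\ldots,T_d)$ of bounded operators on a complex Hilbert space, the Euclidean operator radius is $w_e(\mathbf{T})=\sup\{(\sum_{k=1}^d|\langle T_kx,x\rangle|^2)^{1/2}:\|x\|=1\}$; $w_e^{1/2}(\mathbf{T})$ denotes its square root. Operations on tuples are componentwise: $\mathbf{T}^*=(T_1^*,\ldots,T_d^* )$, $|\mathbf{T}|^s=(|T_1|^s,\ldots,|T_d|^s)$ with $|T|^0=I$ (identity operator), and sums are componentwise. $\mathbf{A_{ij}^*}$ means $(\mathbf{A_{ij}})^*$. If $\mathbf{A_{ij}}=(A_{ij}^1,\ldots,A_{ij}^d)$, the operator matrix $[\mathbf{A_{ij}}]_{n\times n}$ is the $d$-tuple $([A_{ij}^1]_{n\times n},\ldots,[A_{ij}^d]_{n\times n})$ of operators on $\oplus_{i=1}^n\mathscr{H}$. For a complex $n\times n$ matrix $M$, $w(M)=\sup\{|\langle Mx,x\rangle|:x\in\mathbb{C}^n,\|x\|=1\}$ is its numerical radius. *)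

(* Defs.v *)
From HB Require Import structures.
From mathcomp Require Import all_boot all_order all_algebra.
From mathcomp Require Import sesquilinear spectral.
From mathcomp Require Import complex.
From mathcomp Require Import all_classical all_reals all_analysis.

Set Implicit Arguments.
Unset Strict Implicit.
Unset Printing Implicit Defensive.

Import Order.TTheory GRing.Theory Num.Theory.
Import numFieldNormedType.Exports.
Local Open Scope classical_set_scope.
Local Open Scope ring_scope.
Local Open Scope complex_scope.

(* The inner product is linear in its first argument and conjugate-linear in
   its second one. *)
HB.mixin Record NormedModule_isHilbert (R : realType) H
    & NormedModule R[i] H := {
  hdot : {dot H for (@Num.conj R[i])} ;
  hdot_norm : forall x : H, hdot x x = `|x| ^+ 2
}.

#[short(type="hilbertType")]
HB.structure Definition Hilbert (R : realType) :=
  {H of NormedModule_isHilbert R H & CompleteNormedModule R[i] H}.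

(* Norms of normedZmodType R[i] (in particular moduli of complex numbers) are
   R[i]-valued; rnorm is the same norm as a real number. *)
Definition rnorm (R : realType) (V : normedZmodType R[i]) (x : V) : R :=
  complex.Re `|x|.

Section BoundedOperators.
Context {R : realType} (H : hilbertType R).

Definition bounded_linear : {pred H -> H} :=
  mem [set f : H -> H | linear f /\
                        exists M : R, forall x, `|f x| <= M%:C * `|x|].

Record bop := Bop { bop_fun :> H -> H; bop_funP : bop_fun \in bounded_linear }.

HB.instance Definition _ := [isSub for bop_fun].
HB.instance Definition _ := [Choice of bop by <:].

Lemma bounded_linear_submod_closed : submod_closed bounded_linear.
Proof.
split=> [|a f g]; rewrite !inE /=.
  by split=> [b x y|]; [rewrite scaler0 addr0 | exists 0 => x; rewrite normr0 mul0r].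
move=> [fL [M fM]] [gL [N gN]]; split=> [b x y|].
  rewrite !(addrfctE, scalrfctE) fL gL !scalerDr !scalerA [b * a]mulrC.
  by rewrite addrACA.
exists (rnorm a * M + N) => x; apply: (le_trans (ler_normD _ _)).
rewrite rmorphD rmorphM /= mulrDl lerD// normrZ -mulrA.
by rewrite RRe_real ?ler_wpM2l// normr_real.
Qed.

HB.instance Definition _ := GRing.isSubmodClosed.Build R[i] (H -> H)
  bounded_linear bounded_linear_submod_closed.
HB.instance Definition _ := [SubChoice_isSubLmodule of bop by <:].

Lemma bop_linear (T : bop) : linear T.
Proof. by case: T => f /=; rewrite inE => -[]. Qed.

HB.instance Definition _ (T : bop) :=
  GRing.isLinear.Build R[i] H H _ T (bop_linear T).

Lemma bop_bounded (T : bop) : exists M : R, forall x, `|T x| <= M%:C * `|x|.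
Proof. by case: T => f /=; rewrite inE => -[]. Qed.

Lemma bop_id_subproof : (idfun : H -> H) \in bounded_linear.
Proof. by rewrite inE; split=> //; exists 1 => x; rewrite mul1r. Qed.

Lemma bop_comp_subproof (T S : bop) : (T \o S : H -> H) \in bounded_linear.
Proof.
rewrite inE; split=> [a x y|]; first by rewrite /= linearP linearP.
have [[M TM] [N SN]] := (bop_bounded T, bop_bounded S).
exists (`|M| * N) => x; apply: (le_trans (TM _)).
apply: (@le_trans _ _ (`|M|%:C * `|S x|)).
  by rewrite ler_wpM2r// lecR ler_norm.
by rewrite rmorphM /= -mulrA ler_wpM2l// ler0c.
Qed.

Definition bop_id := Bop bop_id_subproof.
Definition bop_comp T S := Bop (bop_comp_subproof T S).

Lemma bopP (T S : bop) : T =1 S -> T = S.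
Proof. by move=> TS; apply/val_inj/funext. Qed.

Lemma bop_compA : associative bop_comp. Proof. by move=> T S U; exact: bopP. Qed.
Lemma bop_comp1l : left_id bop_id bop_comp. Proof. by move=> T; exact: bopP. Qed.
Lemma bop_comp1r : right_id bop_id bop_comp. Proof. by move=> T; exact: bopP. Qed.
Lemma bop_compDl : left_distributive bop_comp +%R.
Proof. by move=> T S U; exact: bopP. Qed.
Lemma bop_compDr : right_distributive bop_comp +%R.
Proof. by move=> T S U; apply: bopP => x; exact: linearD. Qed.

HB.instance Definition _ := GRing.Zmodule_isPzRing.Build bop
  bop_compA bop_comp1l bop_comp1r bop_compDl bop_compDr.

Definition opnorm (T : bop) : R :=
  sup [set rnorm (T x) | x in [set x : H | `|x| <= 1]].

(* The adjoint exists and is unique by the Riesz representation theorem. *)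
Definition adjoint (T : bop) : bop :=
  xget 0 [set S : bop | forall x y, hdot (T x) y = hdot x (S y)].

Definition opoly (p : {poly R}) (T : bop) : bop :=
  \sum_(k < size p) (p`_k)%:C *: T ^+ k.

(* Continuous functional calculus for t |-> t^s: if 0 <= T then the spectrum of
   T lies in [0, ||T||], and for s >= 0 the operator T^s is the norm limit of
   p_m(T) for any polynomials p_m converging to t^s uniformly on [0, ||T||].
   As 0 `^ 0 = 1, one gets T^0 = I. The operator is only meaningful for T
   positive and s >= 0. *)
Definition opower (T : bop) (s : R) : bop :=
  xget 0 [set S : bop | exists p : nat -> {poly R},
    {uniform `[0, opnorm T], (fun m t => (p m).[t]) @ \oo --> (fun t => t `^ s)}
    /\ (fun m => opnorm (opoly (p m) T - S)) @ \oo --> (0 : R)].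

Definition opabs (T : bop) : bop := opower (adjoint T * T) 2^-1.

Section Tuples.
Context {d : nat}.
Implicit Types T S : 'I_d -> bop.

Definition tadjoint T : 'I_d -> bop := fun k => adjoint (T k).
Definition tabs T : 'I_d -> bop := fun k => opabs (T k).
Definition tpower T (s : R) : 'I_d -> bop := fun k => opower (T k) s.
Definition tadd T S : 'I_d -> bop := fun k => T k + S k.

(* For H = 0 this is sup set0 = 0. *)
Definition euclidean_radius T : R :=
  sup [set Num.sqrt (\sum_(k < d) rnorm (hdot (T k x) x) ^+ 2)
      | x in [set x : H | `|x| = 1]].

End Tuples.
End BoundedOperators.

(* The Hilbert space direct sum of n copies of H. *)
Definition hsum (R : realType) (H : hilbertType R) (n : nat) : Type :=
  {ffun 'I_n -> H}.

Section DirectSum.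
Context {R : realType} (H : hilbertType R) (n : nat).
Local Notation C := R[i].
Local Notation Hn := (hsum H n).

HB.instance Definition _ := GRing.Lmodule.on Hn.

Definition hsum_norm (x : Hn) : C := sqrtC (\sum_i `|x i| ^+ 2).
Definition hsum_dot (x y : Hn) : C := \sum_i hdot (x i) (y i).

Lemma sumsq_ge0 (x : Hn) : 0 <= \sum_i `|x i| ^+ 2.
Proof. by apply: sumr_ge0 => i _; rewrite exprn_ge0. Qed.

Lemma hsum_norm_sqr (x : Hn) : hsum_norm x ^+ 2 = \sum_i `|x i| ^+ 2.
Proof. by rewrite sqrtCK. Qed.

Lemma hsum_norm_triangle (x y : Hn) :
  hsum_norm (x + y) <= hsum_norm x + hsum_norm y.
Proof.
pose v (x : Hn) : 'rV[C]_n := \row_i `|x i|.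
have vE z : hsum_norm z = sqrtC (dotmx (v z) (v z)).
  congr sqrtC; rewrite dotmxE mxE; apply: eq_bigr => i _.
  by rewrite !mxE -normCK normr_id.
apply: (@le_trans _ _ (sqrtC (dotmx (v x + v y) (v x + v y)))); last first.
  by rewrite !vE (triangle_lerif (@dotmx _ n)).
rewrite ler_sqrtC ?nnegrE ?sumsq_ge0//; last first.
  exact: (dnorm_ge0 (@dotmx _ n)).
rewrite dotmxE mxE; apply: ler_sum => i _; rewrite !mxE -normCK !ffunE.
rewrite [X in _ <= X ^+ 2]ger0_norm ?addr_ge0//.
by rewrite lerXn2r ?nnegrE ?addr_ge0// ler_normD.
Qed.

Lemma hsum_normZ (a : C) (x : Hn) : hsum_norm (a *: x) = `|a| * hsum_norm x.
Proof.
rewrite /hsum_norm -[`|a| in RHS](@sqrCK C)// -sqrtCM ?nnegrE ?exprn_ge0 ?sumsq_ge0//.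
congr sqrtC; rewrite mulr_sumr; apply: eq_bigr => i _.
by rewrite ffunE normrZ exprMn.
Qed.

Lemma hsum_norm0_eq0 (x : Hn) : hsum_norm x = 0 -> x = 0.
Proof.
move=> /eqP; rewrite sqrtC_eq0 psumr_eq0 => [|i _]; last by rewrite exprn_ge0.
move=> /allP x0; apply/ffunP => i; apply/eqP; rewrite ffunE.
by have := x0 i (mem_index_enum i); rewrite /= expf_eq0 normr_eq0.
Qed.

HB.instance Definition _ := Lmodule_isNormed.Build C Hn
  hsum_norm_triangle hsum_normZ hsum_norm0_eq0.

Lemma hsum_normE (x : Hn) : `|x| = hsum_norm x. Proof. by []. Qed.

Lemma hsum_le_norm (x : Hn) i : `|x i| <= `|x|.
Proof.
rewrite -(@ler_pXn2r _ 2)// ?nnegrE// hsum_normE hsum_norm_sqr.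
by rewrite (bigD1 i)//= lerDl sumr_ge0// => j _; rewrite exprn_ge0.
Qed.

Lemma hsum_norm_le (x : Hn) : `|x| <= \sum_i `|x i|.
Proof.
have s0 : 0 <= \sum_i `|x i| by exact: sumr_ge0.
rewrite -(@ler_pXn2r _ 2)// ?nnegrE// hsum_normE hsum_norm_sqr.
rewrite expr2 mulr_suml; apply: ler_sum => i _.
by rewrite expr2 ler_wpM2l// (bigD1 i)//= lerDl sumr_ge0.
Qed.

Lemma hsum_complete (F : set_system Hn) : ProperFilter F -> cauchy F -> cvg F.
Proof.
move=> FF /cauchy_ballP Fc.
have Fci i : cauchy ((fun x : Hn => x i) @ F).
  apply/cauchy_ballP => e e0.
  have [[A B] /= [FA FB] AB] := Fc _ e0.
  exists ((fun x : Hn => x i) @` A, (fun x : Hn => x i) @` B) => /=.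
    split; first by apply: filterS FA => x Ax; exists x.
    by apply: filterS FB => x Bx; exists x.
  move=> [_ _] /= [[x Ax <-] [y By <-]]; have := AB (x, y) (conj Ax By).
  rewrite -!ball_normE /=; apply: le_lt_trans.
  by have := hsum_le_norm (x - y) i; rewrite !ffunE.
have Fcv i : cvg ((fun x : Hn => x i) @ F) by exact: cauchy_cvg (Fci i).
pose l : Hn := [ffun i => lim ((fun x : Hn => x i) @ F)].
apply/cvg_ex; exists l; apply/cvgrPdist_le => e e0.
have e0' : 0 < e / n.+1%:R by rewrite divr_gt0.
near=> x.
apply: (le_trans (hsum_norm_le _)).
have xl i : `|(l - x) i| <= e / n.+1%:R.
  rewrite !ffunE; move: i; near: x; apply: filter_forall => i.
  by move/cvgrPdist_le : (Fcv i); exact.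
apply: (@le_trans _ _ (\sum_(i < n) (e / n.+1%:R))); first exact: ler_sum.
rewrite sumr_const card_ord -[leLHS]mulr_natr -mulrA ler_piMr ?(ltW e0)//.
by rewrite mulrC ler_pdivrMr// mul1r ler_nat.
Unshelve. all: by end_near. Qed.

HB.instance Definition _ := Uniform_isComplete.Build Hn hsum_complete.

Lemma hsum_dot_bilinear : 
  bilinear_for *%R (@Num.conj C \; *%R) hsum_dot.
Proof.
split=> [y a u v | y a u v] /=; rewrite /hsum_dot mulr_sumr -big_split /=.
  by apply: eq_bigr => i _; rewrite !ffunE linearPl.
by apply: eq_bigr => i _; rewrite !ffunE linearPr.
Qed.

HB.instance Definition _ :=
  bilinear_isBilinear.Build C Hn Hn C _ _ hsum_dot hsum_dot_bilinear.

Lemma hsum_dot_hermitian (x y : Hn) :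
  hsum_dot x y = (-1) ^+ false * Num.conj (hsum_dot y x).
Proof.
rewrite mul1r rmorph_sum /=; apply: eq_bigr => i _.
by rewrite hermC /= mul1r.
Qed.

HB.instance Definition _ :=
  isHermitianSesquilinear.Build C Hn false Num.conj hsum_dot hsum_dot_hermitian.

Lemma hsum_dot_norm (x : Hn) : hsum_dot x x = `|x| ^+ 2.
Proof.
by rewrite hsum_normE hsum_norm_sqr; apply: eq_bigr => i _; exact: hdot_norm.
Qed.

Lemma hsum_dot_gt0 (x : Hn) : x != 0 -> 0 < hsum_dot x x.
Proof. by move=> x0; rewrite hsum_dot_norm exprn_gt0// normr_gt0. Qed.

HB.instance Definition _ := isDotProduct.Build C Hn hsum_dot hsum_dot_gt0.

HB.instance Definition _ :=
  NormedModule_isHilbert.Build R Hn (hdot := hsum_dot) hsum_dot_norm.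

End DirectSum.

Section OperatorMatrix.
Context {R : realType} {H : hilbertType R} {n : nat}.

Definition opmx_fun (A : 'M[bop H]_n) (x : hsum H n) : hsum H n :=
  [ffun i => \sum_j A i j (x j)].

Lemma opmx_subproof (A : 'M[bop H]_n) :
  opmx_fun A \in @bounded_linear R (hsum H n).
Proof.
rewrite inE; split=> [a x y|].
  apply/ffunP => i; rewrite !ffunE scaler_sumr -big_split /=.
  by apply: eq_bigr => j _; rewrite !ffunE linearP.
have [M AM] : exists M : 'I_n -> 'I_n -> R,
    forall i j x, `|A i j x| <= (M i j)%:C * `|x|.
  have /choice[M AM] : forall ij : 'I_n * 'I_n, exists M : R,
      forall x, `|A ij.1 ij.2 x| <= M%:C * `|x|.
    by move=> ij; exact: bop_bounded.
  by exists (fun i j => M (i, j)) => i j; exact: (AM (i, j)).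
exists (\sum_i \sum_j `|M i j|) => x.
apply: (le_trans (hsum_norm_le _)).
rewrite rmorph_sum mulr_suml; apply: ler_sum => i _; rewrite ffunE.
apply: (le_trans (ler_norm_sum _ _ _)).
rewrite rmorph_sum mulr_suml; apply: ler_sum => j _.
apply: (le_trans (AM i j _)).
apply: (@le_trans _ _ (`|M i j|%:C * `|x j|)).
  by rewrite ler_wpM2r// lecR ler_norm.
by rewrite ler_wpM2l ?hsum_le_norm// ler0c.
Qed.

Definition opmx (A : 'M[bop H]_n) : bop (hsum H n) := Bop (opmx_subproof A).

Definition topmx {d : nat} (A : 'M['I_d -> bop H]_n) : 'I_d -> bop (hsum H n) :=
  fun k => opmx (\matrix_(i, j) A i j k).

End OperatorMatrix.

Definition numerical_radius {R : realType} {n : nat} (M : 'M[R[i]]_n) : R :=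
  sup [set rnorm (\sum_i (M *m x) i 0 * Num.conj (x i 0))
      | x in [set x : 'cV[R[i]]_n | \sum_i rnorm (x i 0) ^+ 2 = 1]].

(* Main.v *)
Require Import Defs.
From mathcomp Require Import all_boot all_order all_algebra.
From mathcomp Require Import sesquilinear.
From mathcomp Require Import complex.
From mathcomp Require Import all_classical all_reals all_analysis.
From mathcomp Require Import ring lra.

Set Implicit Arguments.
Unset Strict Implicit.
Unset Printing Implicit Defensive.

Import Order.TTheory GRing.Theory Num.Theory.
Import numFieldNormedType.Exports.
Local Open Scope classical_set_scope.
Local Open Scope ring_scope.
Local Open Scope complex_scope.

(** For a unit vector x = (x_1, ..., x_n) of the direct sum, the form
    <A_k x, x> is the double sum of the <A_ij^k x_j, x_i>.  The Euclidean norm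
    over k is subadditive, so the pairs (i, j) and (j, i) can be grouped and
    estimated separately: a diagonal pair contributes at most
    w_e(A_ii) |x_i|^2, and an off-diagonal one at most b_ij |x_i| |x_j|.  The
    total is then the quadratic form of the real matrix [b_ij] at the unit
    vector (|x_1|, ..., |x_n|), hence at most w([b_ij])
    ([euclidean_radius_topmx_le]).

    The off-diagonal estimate ([offdiag_le]) is the mixed Schwarz inequality
    [mixed_schwarz],
      |<T x, y>|^2 <= <|T|^(2a) x, x> <|T*|^(2(1-a)) y, y>   (0 <= a <= 1),
    applied to A_ij and A_ji and followed by the Cauchy-Schwarz inequality in
    the index k.  The second bound is the case a = 1/2.

    Mixed Schwarz would follow at once from a polar decomposition T = U|T|.
    Here U is replaced by the contraction V = T (|T| + e)^-1, which only needs
    a functional calculus for continuous functions: since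
    T |T|^(1-a) = |T*|^(1-a) T, one has T = |T*|^(1-a) V |T|^a + e V, and e
    tends to 0 ([factorization_schwarz]).

    The functional calculus of a positive operator T of norm at most M rests
    on the bound |q(T)| <= sup of |q| over [0, M] for real polynomials q
    ([opoly_le]), which is obtained without any spectral theory: if |q(T)| = c
    exceeded the supremum, q^2 - c^2 would split over the complex numbers into
    linear factors having no root in [0, M]; each T - z is then bounded below,
    hence so is q(T)^2 - c^2, whereas c^2 is an approximate eigenvalue of
    q(T)^2.  With the Weierstrass approximation theorem
    ([weierstrass_approx]) and the completeness of the Hilbert space this
    yields the operators T^s.  Adjoints exist by the Riesz representation
    theorem ([riesz]). *)

(** * Polynomial approximation on a segment *)

Section BernsteinApproximation.
Variable R : realType.
Implicit Types (f g : R -> R) (phi psi : nat -> R) (M t e : R).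

Definition unif_cont_on M f :=
  forall e, 0 < e -> exists2 d : R, 0 < d & forall x y,
    0 <= x <= M -> 0 <= y <= M -> `|x - y| <= d -> `|f x - f y| <= e.

(** The value at t is the expectation of phi under the binomial law with
    parameters n and t; the recursion conditions on the first trial. *)
Fixpoint bernstein (n : nat) phi : {poly R} :=
  if n is m.+1 then 'X * bernstein m (phi \o succn) + (1 - 'X) * bernstein m phi
  else (phi 0%N)%:P.

Lemma bernsteinS n phi t : (bernstein n.+1 phi).[t] =
  t * (bernstein n (phi \o succn)).[t] + (1 - t) * (bernstein n phi).[t].
Proof. by rewrite /= !hornerE. Qed.

Lemma le_bernstein n phi psi t : 0 <= t <= 1 ->
  (forall k, (k <= n)%N -> phi k <= psi k) ->
  (bernstein n phi).[t] <= (bernstein n psi).[t].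
Proof.
move=> /andP[t0 t1]; elim: n phi psi => [|n IHn] phi psi le_phi.
  by rewrite !hornerE le_phi.
rewrite !bernsteinS lerD// ler_wpM2l ?subr_ge0//; apply: IHn => k kn.
  by rewrite /= le_phi.
by rewrite le_phi// leqW.
Qed.

(** This is the second moment of a binomial variable about c: squared distance
    of the mean n t from c plus variance n t (1 - t). *)
Lemma bernstein_quadratic n (a b c t : R) :
  (bernstein n (fun k => a + b * (k%:R - c) ^+ 2)).[t]
  = a + b * ((n%:R * t - c) ^+ 2 + n%:R * t * (1 - t)).
Proof.
elim: n c => [|n IHn] c; first by rewrite !hornerE; ring.
rewrite bernsteinS IHn.
rewrite (_ : _ \o _ = fun k => a + b * (k%:R - (c - 1)) ^+ 2); last first.
  by apply/funext => k /=; rewrite -natr1; ring.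
by rewrite IHn -natr1; ring.
Qed.

(** Chebyshev's argument: off the d-neighbourhood of t, where uniform
    continuity says nothing, the oscillation 2 B of f is absorbed by a multiple
    of the squared distance to t.  So f is squeezed between two
    quadratic polynomials, whose Bernstein polynomials are known exactly and
    differ from f t by e / 2 + O(1 / n). *)
Lemma weierstrass_approx M f (B : R) :
  0 <= M -> (forall t, 0 <= t <= M -> `|f t| <= B) -> unif_cont_on M f ->
  forall e, 0 < e ->
  exists p : {poly R}, forall t, 0 <= t <= M -> `|p.[t] - f t| <= e.
Proof.
move=> M0 fB fc e e0.
have B0 : 0 <= B by apply: le_trans (fB 0 _); rewrite ?normr_ge0 ?lexx.
have [d d0 fd] := fc (e / 2) (divr_gt0 e0 (ltr0Sn R 1)).
have [C C0 CE] : exists2 C : R, 0 <= C & C = 2 * B * M ^+ 2 / d ^+ 2.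
  by eexists; last reflexivity; rewrite divr_ge0 ?sqr_ge0// !mulr_ge0 ?sqr_ge0//.
have [n n0 nC] : exists2 n : nat, 0 < n%:R :> R & C / n%:R <= e / 2.
  exists (Num.truncn (C / (e / 2))).+1; first by rewrite ltr0n.
  rewrite ler_pdivrMr ?ltr0n// mulrC -ler_pdivrMr; last by rewrite divr_gt0.
  by rewrite ltW// truncnS_gt.
pose phi k := f (M * (k%:R / n%:R)).
exists (bernstein n phi \Po (M^-1 *: 'X)) => t tM.
rewrite horner_comp !hornerE; set u := M^-1 * t.
(* For M = 0 the convention 0^-1 = 0 makes u = 0 the right rescaling. *)
have [t0 tM'] := andP tM.
have u01 : 0 <= u <= 1.
  rewrite /u mulr_ge0 ?invr_ge0//=.
  have [->|Mn0] := eqVneq M 0; first by rewrite invr0 mul0r ler01.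
  by rewrite mulrC ler_pdivrMr ?mul1r// lt_def Mn0.
have tE : t = M * u.
  rewrite /u; have [M00|Mn0] := eqVneq M 0; last by rewrite mulVKf.
  by rewrite M00 mul0r; apply/eqP; rewrite eq_le t0 -[X in _ <= X]M00 tM'.
have key k : (k <= n)%N ->
    `|phi k - f t| <= e / 2 + C / n%:R ^+ 2 * (k%:R - n%:R * u) ^+ 2.
  move=> kn; have kM : 0 <= M * (k%:R / n%:R) <= M.
    rewrite mulr_ge0 ?divr_ge0//= ler_piMr// ler_pdivrMr// mul1r.
    by rewrite ler_nat.
  have [ltd|gtd] := leP `|M * (k%:R / n%:R) - t| d.
    have := fd _ _ kM tM ltd; rewrite -/(phi k) => /le_trans; apply.
    by rewrite lerDl mulr_ge0 ?divr_ge0 ?sqr_ge0.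
  rewrite (@le_trans _ _ (2 * B))//.
    by rewrite (le_trans (ler_normB _ _))// mulr2n mulrDl mul1r lerD// fB.
  rewrite ler_wpDl ?(ltW (divr_gt0 e0 _))// CE.
  have -> : 2 * B * M ^+ 2 / d ^+ 2 / n%:R ^+ 2 * (k%:R - n%:R * u) ^+ 2
          = 2 * B * ((M * (k%:R / n%:R) - t) / d) ^+ 2.
    by rewrite tE; field; rewrite !gt_eqF.
  rewrite ler_peMr ?mulr_ge0// -real_normK ?num_real// exprn_ege1//.
  by rewrite normrM normfV (gtr0_norm d0) ler_pdivlMr// mul1r ltW.
have small : C / n%:R ^+ 2 * ((n%:R * u - n%:R * u) ^+ 2 + n%:R * u * (1 - u))
    <= e / 2.
  rewrite (_ : _ * _ = C / n%:R * (u * (1 - u))); last first.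
    by field; rewrite gt_eqF.
  apply: le_trans nC; rewrite ler_piMr ?(divr_ge0 C0 (ltW n0))//.
  have [u0 u1] := andP u01.
  by rewrite (le_trans _ u1)// ler_piMr// gerBl.
set w := _ + _ in small.
have lo : f t - e / 2 - C / n%:R ^+ 2 * w <= (bernstein n phi).[u].
  rewrite -[- (C / _ * _)]mulNr /w -bernstein_quadratic;
    apply: le_bernstein => // k kn.
  have := key k kn; rewrite ler_norml mulNr; lra.
have hi : (bernstein n phi).[u] <= f t + e / 2 + C / n%:R ^+ 2 * w.
  rewrite /w -bernstein_quadratic; apply: le_bernstein => // k kn.
  have := key k kn; rewrite ler_norml; lra.
rewrite ler_norml; lra.
Qed.

(** Subadditivity of the s-th power: z / x <= (z / x)^s for z in [0, x], summed
    over z = x - y and z = y. *)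
Lemma powR_dist (s x y : R) : 0 < s <= 1 -> 0 <= x -> 0 <= y ->
  `|x `^ s - y `^ s| <= `|x - y| `^ s.
Proof.
move=> /andP[s0 s1]; wlog xy : x y / y <= x => [hw|] x0 y0.
  have [yx|/ltW xy] := leP y x; first exact: hw.
  by rewrite distrC [`|x - y|]distrC; exact: hw.
rewrite !ger0_norm ?subr_ge0//; last by rewrite ge0_ler_powR// ltW.
have [->|xn0] := eqVneq x 0; first by rewrite powR0 ?gt_eqF//
  sub0r (@le_trans _ _ 0) ?oppr_le0 ?powR_ge0.
have {xn0}x0 : 0 < x by rewrite lt_def xn0.
have sub z : 0 <= z <= x -> z / x * x `^ s <= z `^ s.
  move=> /andP[z0 zx].
  rewrite -[in leRHS](divfK (lt0r_neq0 x0) z) powRM ?divr_ge0 ?(ltW x0)//.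
  rewrite ler_wpM2r ?powR_ge0//.
  have [->|zn0] := eqVneq z 0; first by rewrite mul0r powR_ge0.
  have {zn0}z0 : 0 < z by rewrite lt_def zn0.
  by rewrite ger1_powR// divr_gt0//= ler_pdivrMr ?mul1r.
rewrite lerBlDr (le_trans _ (lerD (sub (x - y) _) (sub y _))) ?y0 ?xy//.
  by rewrite -mulrDl -mulrDl subrK divff ?mul1r// gt_eqF.
by rewrite subr_ge0 xy lerBlDr lerDl.
Qed.

Lemma powR_unif_cont (M s : R) : 0 <= s <= 1 -> unif_cont_on M (fun t => t `^ s).
Proof.
move=> /andP[s0 s1] e e0.
have [->|sn0] := eqVneq s 0.
  by exists 1 => // x y _ _ _; rewrite !powRr0 subrr normr0 (ltW e0).
have {sn0}s0 : 0 < s by rewrite lt_def sn0.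
exists (e `^ s^-1) => [|x y /andP[x0 _] /andP[y0 _] xy]; first exact: powR_gt0.
rewrite (le_trans (powR_dist _ _ _)) ?s0//.
rewrite -[leRHS]powRr1 ?(ltW e0)// -(mulVf (lt0r_neq0 s0)) powRrM.
by rewrite ge0_ler_powR ?nnegrE ?powR_ge0 ?(ltW s0).
Qed.

Lemma powR_approx (M s : R) : 0 <= M -> 0 <= s <= 1 -> forall e, 0 < e ->
  exists p : {poly R}, forall t, 0 <= t <= M -> `|p.[t] - t `^ s| <= e.
Proof.
move=> M0 s01; apply: (@weierstrass_approx _ _ (M `^ s)) => //; last first.
  exact: powR_unif_cont.
move=> t /andP[t0 tM]; have [s0 _] := andP s01.
by rewrite ger0_norm ?powR_ge0// ge0_ler_powR.
Qed.

Lemma inv_approx (M c : R) : 0 <= M -> 0 < c -> forall e, 0 < e ->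
  exists p : {poly R}, forall t, 0 <= t <= M -> `|p.[t] - (t + c)^-1| <= e.
Proof.
move=> M0 c0.
have le_inv t : 0 <= t -> 0 <= (t + c)^-1 <= c^-1.
  move=> t0; rewrite invr_ge0 lef_pV2 ?posrE ?ltr_wpDl// lerDr t0 andbT.
  by rewrite addr_ge0// ltW.
apply: (@weierstrass_approx _ _ c^-1) => // [t /andP[t0 _]|e e0].
  by have /andP[? ?] := le_inv _ t0; rewrite ger0_norm.
exists (e * c ^+ 2) => [|x y /andP[x0 _] /andP[y0 _] xy].
  by rewrite mulr_gt0 ?exprn_gt0.
have [xc yc] : x + c != 0 /\ y + c != 0 by rewrite !gt_eqF ?ltr_wpDl.
have -> : (x + c)^-1 - (y + c)^-1 = (y - x) * ((x + c)^-1 * (y + c)^-1).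
  by field; rewrite xc yc.
rewrite normrM distrC (@le_trans _ _ (e * c ^+ 2 * (c^-1 * c^-1)))//; last first.
  by rewrite -mulrA -expr2 exprVn mulfV ?mulr1// expf_neq0// gt_eqF.
have [/andP[? ?] /andP[? ?]] := (le_inv _ x0, le_inv _ y0).
by rewrite ler_pM// ger0_norm ?mulr_ge0// ler_pM.
Qed.
End BernsteinApproximation.

(** * Real-valued norms and the inner product *)

Section RealNorm.
Context {R : realType}.

(** Declaring R as the codomain places the values in the real field R itself,
    not in the real closed field from which the complex numbers are built. *)
Definition re (z : R[i]) : R := complex.Re z.

Lemma reB (x y : R[i]) : re (x - y) = re x - re y.
Proof. by case: x y => a b []. Qed.
Lemma reR (x : R) : re x%:C = x. Proof. by []. Qed.
Lemma leC (x y : R) : (x%:C <= y%:C) = (x <= y). Proof. exact: lecR. Qed.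
Lemma ltC (x y : R) : (x%:C < y%:C) = (x < y). Proof. exact: ltcR. Qed.
Lemma geC0 (x : R) : (0 <= x%:C) = (0 <= x). Proof. exact: ler0c. Qed.

Lemma rnormE (V : normedZmodType R[i]) (x : V) : `|x| = (rnorm x)%:C.
Proof. by rewrite /rnorm RRe_real// normr_real. Qed.

Lemma rnorm_ge0 (V : normedZmodType R[i]) (x : V) : 0 <= rnorm x.
Proof. by rewrite -geC0 -rnormE. Qed.

Lemma le_rnorm (V W : normedZmodType R[i]) (x : V) (y : W) (M : R) :
  (`|x| <= M%:C * `|y|) = (rnorm x <= M * rnorm y).
Proof. by rewrite !rnormE -rmorphM leC. Qed.

Lemma rnormD (V : normedZmodType R[i]) (x y : V) :
  rnorm (x + y) <= rnorm x + rnorm y.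
Proof. by have := ler_normD x y; rewrite !rnormE -rmorphD leC. Qed.

Lemma rnormN (V : normedZmodType R[i]) (x : V) : rnorm (- x) = rnorm x.
Proof. by rewrite /rnorm normrN. Qed.

Lemma rdistC (V : normedZmodType R[i]) (x y : V) : rnorm (x - y) = rnorm (y - x).
Proof. by rewrite -rnormN opprB. Qed.

Lemma rdist_tri (V : normedZmodType R[i]) (x y z : V) :
  rnorm (x - z) <= rnorm (x - y) + rnorm (y - z).
Proof. by rewrite (le_trans _ (rnormD _ _))// addrA subrK. Qed.

Lemma rnorm0 (V : normedZmodType R[i]) : rnorm (0 : V) = 0.
Proof. by rewrite /rnorm normr0. Qed.

Lemma rnorm_eq0 (V : normedZmodType R[i]) (x : V) : (rnorm x == 0) = (x == 0).
Proof. by rewrite -[RHS]normr_eq0 rnormE -[0 : R[i]]/(0%:C) (inj_eq (@complexI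
  _)). Qed.

Lemma rnormZ (V : normedModType R[i]) (a : R[i]) (x : V) :
  rnorm (a *: x) = rnorm a * rnorm x.
Proof. by apply: (@complexI R); rewrite rmorphM /= -!rnormE normrZ. Qed.

Lemma rnormM (a b : R[i]) : rnorm (a * b) = rnorm a * rnorm b.
Proof. by apply: (@complexI R); rewrite rmorphM /= -!rnormE normrM. Qed.

Lemma rnorm_real (a : R) : rnorm a%:C = `|a|.
Proof. by rewrite /rnorm normc_def /= expr0n /= addr0 sqrtr_sqr. Qed.

Lemma rnormC (z : R[i]) : rnorm (Num.conj z) = rnorm z.
Proof. by rewrite /rnorm norm_conjC. Qed.

Lemma ler_re_rnorm (z : R[i]) : `|re z| <= rnorm z.
Proof. by have := normc_ge_Re z; rewrite rnormE leC. Qed.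

Lemma ler_Im_rnorm (z : R[i]) : `|complex.Im z| <= rnorm z.
Proof.
have := ler_re_rnorm ('i%C * z).
rewrite rnormM (_ : rnorm 'i%C = 1); last first.
  by rewrite /rnorm normc_def /= expr0n /= expr1n add0r sqrtr1.
by case: z => a b /=; rewrite mul0r mul1r sub0r normrN mul1r.
Qed.

Lemma rnorm_sum (V : normedZmodType R[i]) (I : Type) (r : seq I) (P :
  pred I) (F : I -> V) :
  rnorm (\sum_(i <- r | P i) F i) <= \sum_(i <- r | P i) rnorm (F i).
Proof.
by elim/big_rec2: _ => [|i a x _ ax]; rewrite ?rnorm0//
  (le_trans (rnormD _ _))// lerD2l.
Qed.

Lemma reZ (a : R) (z : R[i]) : re (a%:C * z) = a * re z.
Proof. by case: z => x y; rewrite /re /= mul0r subr0. Qed.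

Lemma real_complexP (z : R[i]) : 0 <= z -> z = (re z)%:C.
Proof. by move=> z0; rewrite RRe_real// ger0_real. Qed.

End RealNorm.

Section Dot.
Context {R : realType} {H : hilbertType R}.
Implicit Types (x y z : H) (a : R[i]).

Lemma hdotDl x y z : hdot (x + y) z = hdot x z + hdot y z.
Proof. by rewrite linearDl. Qed.
Lemma hdotDr x y z : hdot z (x + y) = hdot z x + hdot z y.
Proof. by rewrite linearDr. Qed.
Lemma hdotNr x y : hdot x (- y) = - hdot x y.
Proof. by rewrite linearNr. Qed.
Lemma hdotBl x y z : hdot (x - y) z = hdot x z - hdot y z.
Proof. by rewrite linearBl. Qed.
Lemma hdotBr x y z : hdot z (x - y) = hdot z x - hdot z y.
Proof. by rewrite linearBr. Qed.
Lemma hdotZl a x y : hdot (a *: x) y = a * hdot x y.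
Proof. by rewrite linearZl_LR. Qed.
Lemma hdotZr a x y : hdot x (a *: y) = Num.conj a * hdot x y.
Proof. by rewrite linearZr_LR. Qed.
Lemma hdot0l x : hdot 0 x = 0.
Proof. by rewrite linear0l. Qed.
Lemma hdot0r x : hdot x 0 = 0.
Proof. by rewrite linear0r. Qed.
Lemma hdotC x y : hdot x y = Num.conj (hdot y x).
Proof. by rewrite hermC /= mul1r. Qed.
Lemma hdotxx x : hdot x x = (rnorm x ^+ 2)%:C.
Proof. by rewrite hdot_norm rnormE rmorphXn. Qed.

Lemma conjc_realE (b : R) : Num.conj (b%:C) = b%:C :> R[i].
Proof. by rewrite -[LHS]/(conjc _) conjc_real. Qed.

Lemma rnorm_sqrD x y :
  rnorm (x + y) ^+ 2 = rnorm x ^+ 2 + rnorm y ^+ 2 + 2 * re (hdot x y).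
Proof.
apply: (@complexI R); rewrite -hdotxx hdotDl !hdotDr !hdotxx (hdotC y x).
by apply/eqP; rewrite eq_complex /=; case: (hdot x y) => u v; rewrite /re /=;
  apply/andP; split; apply/eqP; ring.
Qed.

Lemma rnorm_sqrB x y :
  rnorm (x - y) ^+ 2 = rnorm x ^+ 2 + rnorm y ^+ 2 - 2 * re (hdot x y).
Proof.
by rewrite rnorm_sqrD rnormN hdotNr; case: (hdot x y) => u v; rewrite /re /=; ring.
Qed.

Lemma rnorm_sqr (z : R[i]) : rnorm z ^+ 2 = re z ^+ 2 + complex.Im z ^+ 2.
Proof. by apply: (@complexI R); rewrite add_Re2_Im2 rnormE rmorphXn. Qed.

Lemma re_mulJ (z : R[i]) : re (Num.conj z * z) = rnorm z ^+ 2.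
Proof. by rewrite rnorm_sqr; case: z => u v; rewrite /re /=; ring. Qed.

(** Expanding the square of the norm of |y|^2 x - <x, y> y, which is |y|^2
    times the component of x orthogonal to y. *)
Lemma hdot_CS x y : rnorm (hdot x y) <= rnorm x * rnorm y.
Proof.
have [->|y0] := eqVneq y 0; first by rewrite hdot0r !rnorm0 mulr0.
have {}y0 : 0 < rnorm y by rewrite lt_def rnorm_eq0 y0 rnorm_ge0.
have := sqr_ge0 (rnorm ((rnorm y ^+ 2)%:C *: x - hdot x y *: y)).
rewrite rnorm_sqrB !rnormZ rnorm_real hdotZl hdotZr reZ re_mulJ.
rewrite ger0_norm ?sqr_ge0// => h.
rewrite -ler_sqr ?nnegrE ?mulr_ge0 ?rnorm_ge0//.
rewrite -(ler_pM2l (exprn_gt0 2 y0)); nra.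
Qed.

Lemma hdot_inj x y : (forall z, hdot z x = hdot z y) -> x = y.
Proof.
move=> xy; apply/eqP; rewrite -subr_eq0 -rnorm_eq0 -sqrf_eq0.
by rewrite -(inj_eq (@complexI R)) -hdotxx hdotBr xy subrr.
Qed.

End Dot.

(** * The Riesz representation theorem and adjoints *)

Section Completeness.
Context {R : realType} {H : hilbertType R}.

Lemma harmonic_small (e : R) :
  0 < e -> exists N, forall n : nat, (N <= n)%N -> harmonic n <= e.
Proof.
move=> e0; exists (Num.truncn e^-1) => n Nn; rewrite /harmonic.
rewrite invf_ple ?posrE ?ltr0n// ltW//.
by rewrite (lt_le_trans (truncnS_gt _))// ler_nat.
Qed.

Lemma le_addharmonic (a b : R) : (forall n, a <= b + harmonic n) -> a <= b.
Proof.
move=> h; apply/ler_addgt0Pr => e /harmonic_small[N /(_ N (leqnn _)) Ne].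
by rewrite (le_trans (h N))// lerD2l.
Qed.

(** Completeness with an explicit rate: the limit of a sequence that is Cauchy
    at the harmonic rate is approached at the same rate, so that bounds pass to
    the limit without further choices of indices. *)
Lemma hilbert_limit (u : nat -> H) :
  (forall m n, rnorm (u m - u n) <= harmonic m + harmonic n) ->
  exists l, forall n, rnorm (u n - l) <= harmonic n.
Proof.
move=> ucauchy.
have /cauchy_cvg /cvg_ex[l ul] : cauchy (u @ \oo).
  apply/cauchy_ballP => e e0.
  have eE := real_complexP (ltW e0).
  have e0' : 0 < re e by rewrite -ltC -eE.
  have [N uN] := harmonic_small (divr_gt0 e0' (ltr0Sn R 2)).
  exists ([set u n | n in [set n | (N <= n)%N]],
    [set u n | n in [set n | (N <= n)%N]]).
    by split; exists N => // n /= Nn; exists n.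
  move=> [_ _] /= [[m Nm <-] [n Nn <-]]; rewrite -ball_normE /=.
  rewrite rnormE eE ltC (le_lt_trans (ucauchy m n))//.
  by have := uN _ Nm; have := uN _ Nn; lra.
exists l => n; apply: le_addharmonic => k.
have k0 : 0 < harmonic k / 2 :> R by rewrite divr_gt0// harmonic_gt0.
have [N uN] := harmonic_small k0.
have /cvgrPdist_le/(_ (harmonic k / 2)%:C) := ul.
rewrite ltC => /(_ k0)[N' _ lN].
have := lN _ (leq_maxr N N'); rewrite rnormE leC => lm.
have := uN _ (leq_maxl N N') => um.
have := rdist_tri (u n) (u (maxn N N')) l; have := ucauchy n (maxn N N').
by rewrite (rdistC (u (maxn N N')) l); lra.
Qed.

Variables (phi : H -> R[i]) (M : R).
Hypothesis phiP : forall a x z, phi (a *: x + z) = a * phi x + phi z.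
Hypothesis phiM : forall x, rnorm (phi x) <= M * rnorm x.

(* The representing vector of phi is the minimizer of this functional, which
   equals |x - y|^2 - |y|^2 when phi = <_, y>. *)
Let J x := rnorm x ^+ 2 - 2 * re (phi x).

Let phiD x z : phi (x + z) = phi x + phi z.
Proof. by have := phiP 1 x z; rewrite scale1r mul1r. Qed.
Let phi0 : phi 0 = 0.
Proof. by apply: (addrI (phi 0)); rewrite -phiD !addr0. Qed.
Let phiZ a x : phi (a *: x) = a * phi x.
Proof. by rewrite -[a *: x]addr0 phiP phi0 addr0. Qed.

(* The parallelogram identity: a minimizing sequence of J is Cauchy. *)
Let J_mid x z : rnorm (x - z) ^+ 2 = 2 * (J x + J z - 2 * J ((2^-1)%:C *: (x + z))).
Proof.
rewrite /J rnormZ rnorm_real ger0_norm// exprMn rnorm_sqrB rnorm_sqrD.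
by rewrite phiZ reZ phiD; case: (phi x) (phi z) => a b [c e]; rewrite /re /=; field.
Qed.

Let J_line x z (t : R) : J (x + t%:C *: z) =
  J x + 2 * t * re (hdot z x - phi z) + t ^+ 2 * rnorm z ^+ 2.
Proof.
rewrite /J rnorm_sqrD phiD phiZ rnormZ rnorm_real exprMn real_normK ?num_real//.
rewrite hdotZr conjc_realE (hdotC z x).
by case: (hdot x z) (phi x) (phi z) => a b [c e] [f g]; rewrite /re /=; ring.
Qed.

(** A minimizing sequence of J converges by [J_mid].  Comparing J at u n with J
    at the best point of the line through u n directed by z shows that
    <z, u n> - phi z has a small real part; at the limit the real part vanishes
    for every z, and replacing z by i z kills the imaginary part. *)
Theorem riesz : exists y, forall x, phi x = hdot x y.
Proof.
have J_lb x : - M ^+ 2 <= J x.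
  have := phiM x; have := ler_re_rnorm (phi x); rewrite ler_norml => /andP[_].
  by rewrite /J; have := sqr_ge0 (rnorm x - M); nra.
have Jinf : has_inf (range J).
  by split; [exists (J 0), 0|exists (- M ^+ 2) => _ [x _ <-]; exact: J_lb].
set m := inf (range J).
have m_le x : m <= J x by apply: ge_inf; [case: Jinf|exists x].
have /choice[u uJ] n : exists x, J x <= m + harmonic n ^+ 2 / 2.
  have d0 : 0 < harmonic n ^+ 2 / 2 :> R by rewrite divr_gt0// exprn_gt0//
    harmonic_gt0.
  by have [_ [x _ <-] /ltW] := inf_adherent d0 Jinf; exists x.
have [y uy] : exists y, forall n, rnorm (u n - y) <= harmonic n.
  apply: hilbert_limit => i j.
  rewrite -ler_sqr ?nnegrE ?rnorm_ge0 ?addr_ge0 ?harmonic_ge0// J_mid.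
  have := m_le ((2^-1)%:C *: (u i + u j)); have := uJ i; have := uJ j.
  have : 0 <= harmonic i * harmonic j :> R by rewrite mulr_ge0 ?harmonic_ge0.
  lra.
exists y => x; apply/eqP; rewrite eq_sym -subr_eq0.
(* The imaginary part is the real part at i x, up to sign. *)
suff Re0 z : re (hdot z y - phi z) = 0.
  rewrite eq_complex [X in X == _]Re0 eqxx /=; have := Re0 ('i%C *: x).
  by rewrite hdotZl phiZ; case: (hdot x y) (phi x) => a b [c e];
    rewrite /re /= => h; apply/eqP; lra.
have near n : `|re (hdot z (u n) - phi z)| <= rnorm z * harmonic n.
  set a := re _.
  (* The scalar minimizes the quadratic polynomial given by J_line. *)
  have := m_le (u n + (- a / rnorm z ^+ 2)%:C *: z); rewrite J_line -/a.
  have [z0|z0] := eqVneq z 0.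
    by rewrite /a z0 hdot0l phi0 subr0 normr0 mulr_ge0 ?rnorm_ge0 ?harmonic_ge0.
  have {}z0 : 0 < rnorm z by rewrite lt_def rnorm_eq0 z0 rnorm_ge0.
  have -> : J (u n) + 2 * (- a / rnorm z ^+ 2) * a + (- a / rnorm z ^+ 2) ^+ 2
     * rnorm z ^+ 2 = J (u n) - (a / rnorm z) ^+ 2.
    by field; rewrite gt_eqF.
  move=> h; rewrite -ler_pdivrMl// mulrC -[X in _ / X]gtr0_norm// -normfV -normrM.
  rewrite -ler_sqr ?nnegrE ?harmonic_ge0// real_normK ?num_real//.
  by have := uJ n; have := sqr_ge0 (harmonic n : R); lra.
have close n : `|re (hdot z y - phi z)| <= rnorm z * harmonic n *+ 2.
  have -> : hdot z y - phi z = hdot z (u n) - phi z - hdot z (u n - y).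
    by rewrite hdotBr opprB [RHS]addrC addrA subrK.
  rewrite reB mulr2n (le_trans (ler_normB _ _)) ?lerD//.
  by rewrite (le_trans (ler_re_rnorm _))// (le_trans (hdot_CS _ _))//
    ler_wpM2l ?rnorm_ge0.
apply/eqP; rewrite -normr_eq0 eq_le normr_ge0 andbT.
apply/ler_addgt0Pr => e e0; rewrite add0r.
have d0 : 0 < e / (2 * (rnorm z + 1)).
  by rewrite divr_gt0 ?mulr_gt0 ?ltr_wpDl ?rnorm_ge0.
have [N /(_ N (leqnn _)) hN] := harmonic_small d0.
rewrite (le_trans (close N))//.
move: hN; rewrite ler_pdivlMr ?mulr_gt0 ?ltr_wpDl ?rnorm_ge0//.
by have := @harmonic_ge0 R N; lra.
Qed.

End Completeness.

Section Adjoint.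
Context {R : realType} {H : hilbertType R}.
Implicit Types (T S : bop H).

Lemma bop_rbounded T : exists2 M : R, 0 <= M & forall x, rnorm (T x) <= M * rnorm x.
Proof.
have [M TM] := bop_bounded T; exists `|M| => // x.
have := TM x; rewrite le_rnorm => /le_trans; apply.
by rewrite ler_wpM2r ?rnorm_ge0 ?ler_norm.
Qed.

Lemma Bop_rbounded (f : H -> H) (M : R) : linear f ->
  (forall x, rnorm (f x) <= M * rnorm x) -> f \in @bounded_linear R H.
Proof. by move=> fl fM; rewrite inE; split=> //; exists M => x; rewrite le_rnorm. Qed.

(** The Riesz vectors of the forms <T _, y> give the adjoint; it is bounded
    because |T* y|^2 = <T T* y, y>. *)
Lemma adjointP T x y : hdot (T x) y = hdot x (adjoint T y).
Proof.
have [M M0 TM] := bop_rbounded T.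
suff [S TS] : exists S : bop H, forall x y, hdot (T x) y = hdot x (S y).
  rewrite /adjoint; have := @xgetPex _ 0 [set S : bop H |
    forall x y, hdot (T x) y = hdot x (S y)].
  by apply; exists S.
have /choice[f fP] (z : H) : exists w, forall v, hdot (T v) z = hdot v w.
  apply: (@riesz _ _ _ (M * rnorm z)) => [a v w|v].
    by rewrite linearP hdotDl hdotZl.
  by rewrite mulrAC (le_trans (hdot_CS _ _))// ler_wpM2r ?rnorm_ge0.
have flin : linear f.
  move=> a u v; apply: hdot_inj => w.
  by rewrite -fP !(hdotDr, hdotZr) -!fP.
have fM z : rnorm (f z) <= M * rnorm z.
  have [->|fz0] := eqVneq (f z) 0; first by rewrite rnorm0 mulr_ge0 ?rnorm_ge0.
  have {}fz0 : 0 < rnorm (f z) by rewrite lt_def rnorm_eq0 fz0 rnorm_ge0.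
  rewrite -(ler_pM2l fz0) -expr2.
  have -> : rnorm (f z) ^+ 2 = re (hdot (T (f z)) z) by rewrite fP hdotxx.
  rewrite (le_trans (ler_norm _))// (le_trans (ler_re_rnorm _))//.
  rewrite (le_trans (hdot_CS _ _))// mulrA ler_wpM2r ?rnorm_ge0// mulrC.
  exact: TM.
by exists (Bop (Bop_rbounded flin fM)).
Qed.

Lemma adjointPl T x y : hdot (adjoint T x) y = hdot x (T y).
Proof. by rewrite hdotC -adjointP -hdotC. Qed.

Lemma adjointK T : adjoint (adjoint T) = T.
Proof. by apply: bopP => x; apply: hdot_inj => z; rewrite -adjointP adjointPl. Qed.

Lemma opnorm_ub T x : rnorm (T x) <= opnorm T * rnorm x.
Proof.
have [M M0 TM] := bop_rbounded T.
have [->|x0] := eqVneq x 0; first by rewrite linear0 !rnorm0 mulr0.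
have {}x0 : 0 < rnorm x by rewrite lt_def rnorm_eq0 x0 rnorm_ge0.
rewrite -ler_pdivrMr//; apply: ub_le_sup.
  exists M => _ [y y1 <-]; rewrite (le_trans (TM y))// ler_piMr//.
  by move: y1; rewrite /= rnormE -[1]/(1%:C) leC.
exists ((rnorm x)^-1%:C *: x).
  by rewrite /= rnormE rnormZ rnorm_real ger0_norm ?invr_ge0 ?rnorm_ge0//
    mulVf ?gt_eqF.
by rewrite linearZ rnormZ rnorm_real ger0_norm ?invr_ge0 ?rnorm_ge0// mulrC.
Qed.

Lemma opnorm_le T (M : R) : 0 <= M -> (forall x, rnorm (T x) <= M * rnorm x) ->
  opnorm T <= M.
Proof.
move=> M0 TM; apply: ge_sup; first by exists (rnorm (T 0)), 0; rewrite //= normr0.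
move=> _ [y y1 <-]; rewrite (le_trans (TM y))// ler_piMr//.
by move: y1; rewrite /= rnormE -[1]/(1%:C) leC.
Qed.

Lemma opnorm_ge0 T : 0 <= opnorm T.
Proof.
have [M M0 TM] := bop_rbounded T.
apply: (@le_trans _ _ (rnorm (T 0))); first exact: rnorm_ge0.
apply: ub_le_sup; last by exists 0; rewrite //= normr0.
exists M => _ [y y1 <-]; rewrite (le_trans (TM y))// ler_piMr//.
by move: y1; rewrite /= rnormE -[1]/(1%:C) leC.
Qed.

End Adjoint.

(** * Polynomials in a positive operator *)

Section OperatorPolynomials.
Context {R : realType} {H : hilbertType R}.
Implicit Types (T S U : bop H) (p q : {poly R[i]}) (M C t : R).

Lemma bop_scaleAl (a : R[i]) T S : a *: (T * S) = (a *: T) * S.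
Proof. exact: bopP. Qed.

Lemma bop_scaleAr (a : R[i]) T S : a *: (T * S) = T * (a *: S).
Proof. by apply: bopP => x; rewrite /= linearZ. Qed.

(** Complex coefficients are needed because a real polynomial only splits into
    linear factors over the complex numbers. *)
Definition cpoly p T : bop H := \sum_(k < size p) p`_k *: T ^+ k.

Lemma cpoly_widen n p T :
  (size p <= n)%N -> cpoly p T = \sum_(k < n) p`_k *: T ^+ k.
Proof.
move=> pn; rewrite /cpoly (big_ord_widen n (fun k => p`_k *: T ^+ k))//.
rewrite big_mkcond /=; apply: eq_bigr => k _.
by case: ltnP => // /(nth_default 0) ->; rewrite scale0r.
Qed.

Lemma cpolyD p q T : cpoly (p + q) T = cpoly p T + cpoly q T.
Proof.
rewrite (cpoly_widen _ (size_polyD p q)) (cpoly_widen _ (leq_maxl _ (size q))).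
rewrite (cpoly_widen _ (leq_maxr (size p) _)) -big_split /=.
by apply: eq_bigr => k _; rewrite coefD scalerDl.
Qed.

Lemma cpolyZ a p T : cpoly (a *: p) T = a *: cpoly p T.
Proof.
rewrite (cpoly_widen _ (size_scale_leq a p)) scaler_sumr.
by apply: eq_bigr => k _; rewrite coefZ scalerA.
Qed.

Lemma cpolyC a T : cpoly a%:P T = a *: (1 : bop H).
Proof.
by rewrite (@cpoly_widen 1) ?size_polyC ?leq_b1// big_ord1 coefC eqxx expr0.
Qed.

Lemma cpolyMX p T : cpoly (p * 'X) T = cpoly p T * T.
Proof.
rewrite (@cpoly_widen (size p).+1); last first.
  by rewrite (leq_trans (size_polyMleq _ _))// size_polyX addn2.
rewrite big_ord_recl coefMX eqxx scale0r add0r mulr_suml.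
by apply: eq_bigr => k _; rewrite coefMX /= -bop_scaleAl exprSr.
Qed.

Lemma cpolyM p q T : cpoly (p * q) T = cpoly p T * cpoly q T.
Proof.
elim/poly_ind: q => [|q c IHq].
  by rewrite -polyC0 mulr0 !cpolyC !scale0r mulr0.
rewrite mulrDr mulrA !cpolyD !cpolyMX IHq mulrDr mulrA; congr (_ + _).
by rewrite mulrC mul_polyC cpolyZ cpolyC -bop_scaleAr mulr1.
Qed.

Definition rpoly (p : {poly R}) : {poly R[i]} := map_poly (real_complex R) p.

Lemma opolyE (p : {poly R}) T : opoly p T = cpoly (rpoly p) T.
Proof.
rewrite /opoly /cpoly size_map_poly; apply: eq_bigr => k _.
by rewrite coef_map.
Qed.

Lemma opolyD (p q : {poly R}) T : opoly (p + q) T = opoly p T + opoly q T.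
Proof. by rewrite !opolyE /rpoly rmorphD cpolyD. Qed.
Lemma opolyM (p q : {poly R}) T : opoly (p * q) T = opoly p T * opoly q T.
Proof. by rewrite !opolyE /rpoly rmorphM cpolyM. Qed.
Lemma opolyC (c : R) T : opoly c%:P T = c%:C *: (1 : bop H).
Proof. by rewrite opolyE /rpoly map_polyC cpolyC. Qed.
Lemma opolyX T : opoly 'X T = T.
Proof. by rewrite opolyE /rpoly map_polyX -[X in cpoly X]mul1r cpolyMX -polyC1
  cpolyC scale1r mul1r. Qed.
Lemma opolyB (p q : {poly R}) T : opoly (p - q) T = opoly p T - opoly q T.
Proof. by apply/eqP; rewrite eq_sym subr_eq -opolyD subrK. Qed.

Lemma opoly_intertwine (A B U : bop H) (p : {poly R}) :
  U * A = B * U -> U * opoly p A = opoly p B * U.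
Proof.
move=> UA; elim/poly_ind: p => [|p c IHp].
  by rewrite -polyC0 !opolyC !scale0r mulr0 mul0r.
rewrite !(opolyD, opolyM, opolyX, opolyC) mulrDr mulrDl; congr (_ + _).
  by rewrite mulrA IHp -!mulrA UA.
by rewrite -bop_scaleAr -bop_scaleAl mulr1 mul1r.
Qed.

Definition self_adjoint T := forall x y, hdot (T x) y = hdot x (T y).

Lemma opoly_self_adjoint (p : {poly R}) T : self_adjoint T ->
  self_adjoint (opoly p T).
Proof.
move=> Tsym; elim/poly_ind: p => [|p c IHp] x y.
  by rewrite -polyC0 opolyC scale0r hdot0l hdot0r.
rewrite opolyD opolyM opolyX opolyC /= hdotDl hdotDr hdotZl hdotZr conjc_realE.
rewrite IHp Tsym; congr (hdot x _ + _).
by have := opoly_intertwine p (erefl (T * T)) => /(congr1 (fun f : bop H => f y)).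
Qed.

(** Positive operators with spectrum in [0, M].  The bound M is not fixed to be
    the norm of T, so that operators of different norms can share a segment. *)
Record posop (M : R) T : Prop := Posop {
  posop_sym : self_adjoint T;
  posop_ge0 : forall x, 0 <= re (hdot (T x) x);
  posop_le : forall x, rnorm (T x) <= M * rnorm x }.

Definition bounded_below T := exists2 c : R, 0 < c & forall x,
  c * rnorm x <= rnorm (T x).

Lemma bounded_belowM T S : bounded_below T -> bounded_below S ->
  bounded_below (T * S).
Proof.
move=> [c c0 cT] [e e0 eS]; exists (c * e); rewrite ?mulr_gt0// => x.
by rewrite -mulrA (le_trans _ (cT _))// ler_wpM2l// ltW.
Qed.

Lemma hdot_subZ T z x : hdot ((T - z *: (1 : bop H)) x) x
  = hdot (T x) x - z * (rnorm x ^+ 2)%:C.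
Proof. by rewrite -hdotxx -hdotZl -hdotBl. Qed.

(** If Im z <> 0 or z < 0, the quadratic form <(T - z) x, x> is already bounded
    away from 0, since <T x, x> is a nonnegative real number; if z > M, then
    |T x| <= M |x| is dominated by |z x|. *)
Lemma posop_sub_bounded_below M T (z : R[i]) : posop M T ->
  (forall t : R, 0 <= t <= M -> z != t%:C) -> bounded_below (T - z *: (1 : bop H)).
Proof.
move=> [Tsym T0 TM] zM.
have bb (c : R) : 0 < c -> (forall x, c * rnorm x ^+ 2
  <= rnorm (hdot ((T - z *: (1 : bop H)) x) x)) ->
    bounded_below (T - z *: (1 : bop H)).
  move=> c0 cx; exists c => // x; have [->|x0] := eqVneq x 0.
    by rewrite rnorm0 mulr0 rnorm_ge0.
  have {}x0 : 0 < rnorm x by rewrite lt_def rnorm_eq0 x0 rnorm_ge0.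
  by rewrite -(ler_pM2r x0) -mulrA -expr2 (le_trans (cx x))// hdot_CS.
have Treal x : complex.Im (hdot (T x) x) = 0.
  by have := hdotC (T x) x; rewrite Tsym; case: (hdot x (T x)) => a b [] /=; lra.
case: (eqVneq (complex.Im z) 0) => [z0|z0]; last first.
  apply: (bb `|complex.Im z|) => [|x]; first by rewrite normr_gt0.
  rewrite (le_trans _ (ler_Im_rnorm _))// hdot_subZ.
  move: (Treal x) z0; case: (hdot (T x) x) => a b /= ->.
  by case: (z) => u v /= _; rewrite mulr0 !add0r normrN normrM (ger0_norm
    (sqr_ge0 _)) lexx.
have zE : z = (re z)%:C by move: z0; case: (z) => u v /= ->.
have {}zM t : 0 <= t <= M -> re z != t.
  by move=> /zM; rewrite [X in X != _]zE (inj_eq (@complexI _)).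
have [s0|s0] := ltP (re z) 0.
  apply: (bb (- re z)) => [|x]; first by rewrite oppr_gt0.
  rewrite hdot_subZ (le_trans _ (ler_re_rnorm _))// (le_trans _ (ler_norm _))//.
  by rewrite reB [z * _]mulrC reZ; have := T0 x; lra.
have {s0 zM}Ms : M < re z.
  by rewrite ltNge; apply/negP => zM'; have := zM (re z);
    rewrite s0 zM' eqxx => /(_ isT).
exists (re z - M); rewrite ?subr_gt0// => x; rewrite mulrBl lerBlDr.
have := rnormD ((T - z *: (1 : bop H)) x) (- T x).
have -> : (T - z *: (1 : bop H)) x + - T x = - (z *: x).
  by rewrite /= addrAC subrr add0r.
rewrite !rnormN rnormZ => h; have := TM x; have := ler_re_rnorm z.
by have := ler_norm (re z); have := rnorm_ge0 x; nra.
Qed.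

(** The polynomial splits into linear factors X - z with z outside [0, M], and
    operators bounded below are stable under composition. *)
Lemma cpoly_bounded_below M T p : 0 <= M -> posop M T ->
  (forall t : R, 0 <= t <= M -> p.[t%:C] != 0) -> bounded_below (cpoly p T).
Proof.
move=> M0 TM pM; have [s ps] := closed_field_poly_normal p.
have c0 : lead_coef p != 0.
  rewrite lead_coef_eq0; apply/eqP => p0; have := pM 0; rewrite lexx M0 p0.
  by rewrite horner0 eqxx => /(_ isT).
have {}pM (t : R) : 0 <= t <= M -> t%:C \notin s.
  move=> /pM; rewrite ps hornerZ mulf_eq0 (negPf c0)/=; apply: contra => ts.
  by rewrite -[_ == 0]/(root _ _) root_prod_XsubC.
rewrite ps cpolyZ -[X in _ *: X]mul1r bop_scaleAl.
apply: bounded_belowM.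
  exists (rnorm (lead_coef p)); first by rewrite lt_def rnorm_eq0 c0 rnorm_ge0.
  by move=> x; rewrite /= rnormZ.
elim: s {ps c0} pM => [|z s IHs] pM.
  by rewrite big_nil -polyC1 cpolyC scale1r; exists 1 => // x; rewrite mul1r.
rewrite big_cons cpolyM; apply: bounded_belowM.
  rewrite -[X in X - _]mul1r cpolyD cpolyMX -polyC1 cpolyC scale1r mul1r -polyCN
    cpolyC scaleNr.
  apply: posop_sub_bounded_below TM _ => t /pM; rewrite inE eq_sym.
  by apply: contra => ->.
by apply: IHs => t /pM; rewrite inE; apply: contra => ->; rewrite orbT.
Qed.

(** With S = q(T) and c = |S|, the expansion
      |S^2 x - c^2 x|^2 = |S^2 x|^2 - 2 c^2 |S x|^2 + c^4 |x|^2
                       <= c^4 |x|^2 - c^2 |S x|^2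
    shows that S^2 - c^2 cannot be bounded below: that would bound |S x| by
    c' |x| for some c' < c.  But if c were larger than every |q t|, then
    q^2 - c^2 would have no root in [0, M]. *)
Lemma opoly_le M T (q : {poly R}) (C : R) : 0 <= M -> posop M T ->
  (forall t, 0 <= t <= M -> `|q.[t]| <= C) ->
  forall x, rnorm (opoly q T x) <= C * rnorm x.
Proof.
move=> M0 TM qC.
have C0 : 0 <= C by apply: le_trans (qC 0 _); rewrite ?normr_ge0// lexx.
set S := opoly q T; have Ssym : self_adjoint S by apply: opoly_self_adjoint; case: TM.
suff : opnorm S <= C.
  by move=> SC x; rewrite (le_trans (opnorm_ub S x))// ler_wpM2r// rnorm_ge0.
rewrite leNgt; apply/negP; set c := opnorm S => Cc.
have c0 : 0 < c by exact: le_lt_trans Cc.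
have [d d0 dS] : bounded_below (S * S - (c ^+ 2)%:C *: (1 : bop H)).
  have -> : S * S - (c ^+ 2)%:C *: (1 : bop H)
    = cpoly (rpoly (q * q - (c ^+ 2)%:P)) T.
    by rewrite -opolyE opolyB opolyM opolyC.
  apply: cpoly_bounded_below M0 TM _ => t tM.
  rewrite horner_map -[X in _ != X]/(0%:C) (inj_eq (@complexI _)).
  rewrite hornerD hornerM hornerN hornerC -expr2 subr_eq0 lt_eqF//.
  rewrite -real_normK ?num_real// ltr_pXn2r ?nnegrE ?normr_ge0 ?(ltW c0)//.
  exact: le_lt_trans (qC _ tM) Cc.
have key x : (c * rnorm (S x)) ^+ 2 <= (c ^+ 4 - d ^+ 2) * rnorm x ^+ 2.
  have := dS x; rewrite -ler_sqr ?nnegrE ?rnorm_ge0 ?mulr_ge0 ?rnorm_ge0 ?(ltW d0)//.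
  rewrite -[X in _ <= rnorm X ^+ 2]/(S (S x) - (c ^+ 2)%:C *: x).
  rewrite rnorm_sqrB rnormZ rnorm_real hdotZr conjc_realE reZ Ssym hdotxx reR.
  rewrite ger0_norm ?sqr_ge0//.
  have := opnorm_ub S (S x); rewrite -/c -ler_sqr ?nnegrE ?mulr_ge0 ?rnorm_ge0
    ?(ltW c0)//.
  rewrite !exprMn; move: (rnorm (S (S x)) ^+ 2) => w; nra.
(* The difference may be negative, in which case H = 0. *)
pose a := Num.max 0 (c ^+ 4 - d ^+ 2).
have a0 : 0 <= a by rewrite le_max lexx.
have : c <= Num.sqrt a / c.
  apply: opnorm_le => [|x]; first by rewrite divr_ge0 ?sqrtr_ge0 ?ltW.
  rewrite mulrAC ler_pdivlMr// mulrC.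
  rewrite -ler_sqr ?nnegrE ?mulr_ge0 ?rnorm_ge0 ?sqrtr_ge0 ?(ltW c0)//.
  rewrite (le_trans (key x))// exprMn sqr_sqrtr// ler_wpM2r ?sqr_ge0//.
  by rewrite /a le_max lexx orbT.
rewrite ler_pdivlMr// -expr2 -ler_sqr ?nnegrE ?sqrtr_ge0 ?sqr_ge0// sqr_sqrtr//.
rewrite -exprM /a le_max => /orP[]; first by rewrite leNgt exprn_gt0.
by rewrite leNgt gtrBl exprn_gt0.
Qed.

End OperatorPolynomials.

(** * Continuous functional calculus *)

Section FunctionalCalculus.
Context {R : realType} {H : hilbertType R}.
Implicit Types (T S U : bop H) (M C t e : R) (p q : {poly R}) (f g h : R -> R).

Lemma eps_le0 (a K : R) : 0 <= K -> (forall e, 0 < e -> a <= e * K) -> a <= 0.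
Proof.
move=> K0 aK; apply/ler_addgt0Pr => e e0; rewrite add0r.
have d0 : 0 < e / (K + 1) by rewrite divr_gt0 ?ltr_wpDl.
rewrite (le_trans (aK _ d0))// mulrAC ler_pdivrMr ?ltr_wpDl//.
by rewrite ler_wpM2l ?(ltW e0)// lerDl.
Qed.

Lemma rnorm_le0 (x : H) : rnorm x <= 0 -> x = 0.
Proof.
move=> x0; apply/eqP; rewrite -rnorm_eq0 eq_le x0; exact: rnorm_ge0.
Qed.

(** The relation S = f(T).  One polynomial for each precision replaces the
    uniformly convergent sequences of the usual definition; [opower_fcalc]
    relates the two forms. *)
Definition fcalc M T f S := forall e, 0 < e -> exists2 p : {poly R},
  (forall t, 0 <= t <= M -> `|p.[t] - f t| <= e) &
  (forall x, rnorm (opoly p T x - S x) <= e * rnorm x).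

Lemma fcalc_poly M T p : fcalc M T (horner p) (opoly p T).
Proof.
move=> e e0; exists p => [t _|x]; first by rewrite subrr normr0 (ltW e0).
by rewrite subrr rnorm0 mulr_ge0 ?rnorm_ge0 ?(ltW e0).
Qed.

Lemma fcalc_widen M M' T f S : M <= M' -> fcalc M' T f S -> fcalc M T f S.
Proof.
move=> MM fS e /fS[p pf pS]; exists p => // t /andP[t0 tM].
by apply: pf; rewrite t0 (le_trans tM).
Qed.

Section Positive.
Variables (M : R) (T : bop H).
Hypotheses (M0 : 0 <= M) (TM : posop M T).

(** The estimate [opoly_le] passes to the limit.  It contains the uniqueness of
    f(T) and its independence of the approximating polynomials. *)
Lemma fcalc_le f g S S' C : fcalc M T f S -> fcalc M T g S' ->
  (forall t, 0 <= t <= M -> `|f t - g t| <= C) ->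
  forall x, rnorm (S x - S' x) <= C * rnorm x.
Proof.
move=> fS gS' fgC x; rewrite -subr_le0.
apply: (@eps_le0 _ (4 * rnorm x)); first by rewrite mulr_ge0 ?rnorm_ge0.
move=> e e0; have [[p pf pS] [q qg qS]] := (fS _ e0, gS' _ e0).
have pq t : 0 <= t <= M -> `|(p - q).[t]| <= C + 2 * e.
  move=> tM; have := pf t tM; have := qg t tM; have := fgC t tM.
  rewrite hornerD hornerN !ler_norml; lra.
have := opoly_le M0 TM pq x; rewrite opolyB -[X in rnorm X]/(opoly p T x - opoly
  q T x).
have := pS x; have := qS x.
have := rdist_tri (S x) (opoly p T x) (S' x).
have := rdist_tri (opoly p T x) (opoly q T x) (S' x).
rewrite (rdistC (S x) (opoly p T x)); lra.
Qed.

Lemma fcalc_uniq f g S S' : fcalc M T f S -> fcalc M T g S' ->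
  (forall t, 0 <= t <= M -> f t = g t) -> S = S'.
Proof.
move=> fS gS' fg; apply: bopP => x; apply/eqP; rewrite -subr_eq0; apply/eqP.
apply: rnorm_le0; rewrite -(mul0r (rnorm x)); apply: fcalc_le fS gS' _ x => t tM.
by rewrite fg// subrr normr0.
Qed.

Lemma fcalc_bound f S C : fcalc M T f S ->
  (forall t, 0 <= t <= M -> `|f t| <= C) -> forall x, rnorm (S x) <= C * rnorm x.
Proof.
move=> fS fC x; have := fcalc_le fS (fcalc_poly M T 0).
move=> /(_ C) h; rewrite -[S x]subr0.
have -> : (0 : H) = opoly 0 T x by rewrite -polyC0 opolyC scale0r.
by apply: h => t tM; rewrite horner0 subr0 fC.
Qed.

(** The common bound B makes the product of two uniform approximations uniform,
    for the functions as well as for the operators. *)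
Lemma fcalcM f g S S' (B : R) : fcalc M T f S -> fcalc M T g S' ->
  (forall t, 0 <= t <= M -> `|f t| <= B) -> (forall t, 0 <= t <= M -> `|g t| <= B) ->
  fcalc M T (fun t => f t * g t) (S * S').
Proof.
move=> fS gS' fB gB e e0.
have B0 : 0 <= B by apply: le_trans (fB 0 _); rewrite ?normr_ge0 ?lexx.
have [d [d0 d1 dB]] : exists d : R, [/\ 0 < d, d <= 1 & (B + 1) * d + B * d <= e].
  exists (Num.min 1 (e / (2 * B + 1))); rewrite lt_min ltr01 divr_gt0//=; last first.
    by rewrite ltr_wpDl ?mulr_ge0.
  rewrite ge_min lexx; split=> //.
  rewrite -mulrDl (_ : B + 1 + B = 2 * B + 1); last by ring.
  rewrite (@le_trans _ _ ((2 * B + 1) * (e / (2 * B + 1))))//; last first.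
    by rewrite mulrC divfK// gt_eqF// ltr_wpDl ?mulr_ge0.
  by rewrite ler_wpM2l ?addr_ge0 ?mulr_ge0// ge_min lexx orbT.
have [[p pf pS] [q qg qS]] := (fS _ d0, gS' _ d0).
have pB t : 0 <= t <= M -> `|p.[t]| <= B + 1.
  by move=> tM; have := pf t tM; have := fB t tM; rewrite !ler_norml; lra.
exists (p * q) => [t tM|x].
  rewrite hornerM (_ : _ - _ = p.[t] * (q.[t] - g t) + (p.[t] - f t) * g t);
    last by ring.
  rewrite (le_trans (ler_normD _ _))// !normrM (le_trans _ dB)// lerD//.
    by rewrite ler_pM// ?pB// qg.
  by rewrite mulrC ler_pM// ?gB// pf.
rewrite opolyM -[X in rnorm X]/(opoly p T (opoly q T x) - S (S' x)).
rewrite (le_trans (rdist_tri _ (opoly p T (S' x)) _))//.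
rewrite (@le_trans _ _ (((B + 1) * d + B * d) * rnorm x))//; last first.
  by rewrite ler_wpM2r ?rnorm_ge0.
rewrite mulrDl lerD//.
  by rewrite -linearB (le_trans (opoly_le M0 TM pB _))// -mulrA ler_wpM2l ?addr_ge0.
rewrite (le_trans (pS _))// [B * d]mulrC -mulrA ler_wpM2l ?(ltW d0)//.
exact: fcalc_bound gS' gB _.
Qed.

Lemma fcalc_self_adjoint f S : fcalc M T f S -> self_adjoint S.
Proof.
move=> fS x y; apply/eqP; rewrite -subr_eq0 -rnorm_eq0 eq_le rnorm_ge0 andbT.
apply: (@eps_le0 _ (2 * (rnorm x * rnorm y))); first by rewrite !mulr_ge0 ?rnorm_ge0.
move=> e /fS[p _ pS].
have psym := opoly_self_adjoint p (posop_sym TM) x y.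
have -> : hdot (S x) y - hdot x (S y)
        = hdot x (opoly p T y - S y) - hdot (opoly p T x - S x) y.
  by rewrite hdotBl hdotBr psym; ring.
rewrite (le_trans (rnormD _ _))// rnormN (le_trans (lerD (hdot_CS _ _) (hdot_CS
  _ _)))//.
have := pS x; have := pS y; have := rnorm_ge0 x; have := rnorm_ge0 y; nra.
Qed.

(** Along polynomials p n converging at the harmonic rate, the vectors p n (T) x
    converge at that rate times |x|; the pointwise limits form a bounded
    operator. *)
Lemma fcalc_exists f :
  (forall e, 0 < e -> exists p, forall t, 0 <= t <= M -> `|p.[t] - f t| <= e) ->
  exists S, fcalc M T f S.
Proof.
move=> fapprox.
have /choice[p pf] n := fapprox (harmonic n) (harmonic_gt0 n).
have pp m n x : rnorm (opoly (p m) T x - opoly (p n) T x)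
    <= rnorm x * (harmonic m + harmonic n).
  rewrite mulrC; apply: fcalc_le (fcalc_poly _ _ _) (fcalc_poly _ _ _) _ _ => t tM.
  have := pf m t tM; have := pf n t tM; rewrite !ler_norml; lra.
(* Rescaling x to norm 1 brings the sequence to the exact harmonic rate. *)
have /choice[F FP] x : exists l, forall n,
    rnorm (opoly (p n) T x - l) <= harmonic n * rnorm x.
  have [->|x0] := eqVneq x 0.
    by exists 0 => n; rewrite linear0 subr0 rnorm0 mulr0.
  have {}x0 : 0 < rnorm x by rewrite lt_def rnorm_eq0 x0 rnorm_ge0.
  pose u n := (rnorm x)^-1%:C *: opoly (p n) T x.
  have xV : rnorm (rnorm x)^-1%:C = (rnorm x)^-1.
    by rewrite rnorm_real ger0_norm ?invr_ge0 ?(ltW x0).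
  have [l ul] : exists l, forall n, rnorm (u n - l) <= harmonic n.
    apply: hilbert_limit => m n.
    by rewrite -scalerBr rnormZ xV mulrC ler_pdivrMr// mulrC pp.
  exists ((rnorm x)%:C *: l) => n.
  have -> : opoly (p n) T x = (rnorm x)%:C *: u n.
    by rewrite /u scalerA -rmorphM mulfV ?gt_eqF// scale1r.
  by rewrite -scalerBr rnormZ rnorm_real gtr0_norm// mulrC ler_wpM2r ?(ltW x0).
have Flin : linear F.
  move=> a x y; apply/eqP; rewrite -subr_eq0; apply/eqP; apply: rnorm_le0.
  apply: (@eps_le0 _ (rnorm (a *: x + y) + rnorm a * rnorm x + rnorm y)).
    by rewrite !addr_ge0 ?mulr_ge0 ?rnorm_ge0.
  move=> e /harmonic_small[N /(_ N (leqnn _)) hN].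
  set K := _ + _ + _; have K0 : 0 <= K by rewrite !addr_ge0 ?mulr_ge0 ?rnorm_ge0.
  apply: le_trans (ler_wpM2r K0 hN).
  have -> : F (a *: x + y) - (a *: F x + F y)
    = - (opoly (p N) T (a *: x + y) - F (a *: x + y))
     + a *: (opoly (p N) T x - F x) + (opoly (p N) T y - F y).
    rewrite (linearP (opoly (p N) T)) scalerBr opprB -[RHS]addrA.
    by rewrite [X in _ = _ + X]addrACA -opprD [RHS]addrA subrK.
  rewrite (le_trans (rnormD _ _))// mulrDr lerD ?FP//.
  rewrite (le_trans (rnormD _ _))// mulrDr rnormN rnormZ lerD ?FP//.
  by rewrite mulrCA ler_wpM2l ?rnorm_ge0.
have Fbd x : rnorm (F x) <= (opnorm (opoly (p 0%N) T) + 1) * rnorm x.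
  have := FP x 0%N; have := opnorm_ub (opoly (p 0%N) T) x.
  have := rdist_tri (F x) (opoly (p 0%N) T x) 0.
  by rewrite !subr0 /= invr1 (rdistC (F x)); lra.
exists (Bop (Bop_rbounded Flin Fbd)) => e /harmonic_small[N /(_ N (leqnn _)) hN].
exists (p N) => [t tM|x]; first exact: le_trans (pf N t tM) hN.
by rewrite (le_trans (FP x N))// ler_wpM2r ?rnorm_ge0.
Qed.

End Positive.

(** U p(A) = p(B) U for polynomials p approximating f on a segment that serves
    both A and B. *)
Lemma fcalc_intertwine M A B U f S S' : 0 <= M -> posop M A -> posop M B ->
  U * A = B * U -> fcalc M A f S -> fcalc M B f S' -> U * S = S' * U.
Proof.
move=> M0 AM BM UA fS fS'; apply: bopP => x; apply/eqP; rewrite -subr_eq0; apply/eqP.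
have [K K0 UK] := bop_rbounded U.
apply: rnorm_le0; apply: (@eps_le0 _ (2 * (K * rnorm x))).
  by rewrite !mulr_ge0 ?rnorm_ge0.
move=> e e0; have [p pf pS] := fS _ e0.
have pS' y : rnorm (opoly p B y - S' y) <= e * rnorm y.
  exact: fcalc_le (fcalc_poly _ _ _) fS' pf y.
have Up : U (opoly p A x) = opoly p B (U x).
  by have := opoly_intertwine p UA => /(congr1 (fun f : bop H => f x)).
rewrite -[X in rnorm X]/(U (S x) - S' (U x)).
have := rdist_tri (U (S x)) (U (opoly p A x)) (S' (U x)).
rewrite {2}Up -linearB; have := UK (S x - opoly p A x); rewrite (rdistC (S x)).
have := pS x; have := pS' (U x); have := UK x; nra.
Qed.

(** A choice of one polynomial per precision is a uniformly convergent sequence,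
    so the set from which opower picks its value is inhabited; conversely the
    sequence attached to the picked operator provides each precision. *)
Lemma opower_fcalc T (s : R) : posop (opnorm T) T ->
  (exists S, fcalc (opnorm T) T (fun t => t `^ s) S) ->
  fcalc (opnorm T) T (fun t => t `^ s) (opower T s).
Proof.
move=> TM [S fS]; rewrite /opower.
set X := (X in xget _ X).
have XS : X S.
  have /choice[p pP] n : exists p : {poly R},
      (forall t, 0 <= t <= opnorm T -> `|p.[t] - t `^ s| <= harmonic n) /\
      (forall x, rnorm (opoly p T x - S x) <= harmonic n * rnorm x).
    by have [p ? ?] := fS _ (harmonic_gt0 n); exists p.
  exists p; split.
    move=> P /uniform_nbhs[E []]; rewrite -entourage_ballE => -[e e0 Ee] EP.
    have e2 : 0 < e / 2 by exact: divr_gt0.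
    have [N hN] := harmonic_small e2.
    exists N => // n /= /hN nN; apply: EP => t; rewrite /= in_itv => tM.
    apply: Ee; rewrite /= -ball_normE /= distrC.
    rewrite (le_lt_trans (proj1 (pP n) t tM))// (le_lt_trans nN)//.
    by rewrite ltr_pdivrMr// ltr_pMr// ltr1n.
  apply/cvgrPdist_le => e /harmonic_small[N hN]; exists N => // n /= /hN nN.
  rewrite sub0r normrN ger0_norm ?opnorm_ge0// (le_trans _ nN)//.
  by apply: opnorm_le => [|x]; [exact: harmonic_ge0|exact: (proj2 (pP n) x)].
have [p [pf pS]] := @xgetPex _ 0 X (ex_intro _ S XS).
move=> e e0.
have /pf[N _ pfN] : nbhs ((fun t => t `^ s) : {uniform` `[0, opnorm T]%classic -> R})
    [set g | forall t, 0 <= t <= opnorm T -> `|g t - t `^ s| <= e].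
  apply/uniform_nbhs; exists [set xy | ball xy.1 e xy.2]; split.
    exact: entourage_ball (PosNum e0).
  move=> g /= gE t tM; have := gE t; rewrite /= in_itv => /(_ tM).
  by rewrite -ball_normE /= distrC => /ltW.
have /cvgrPdist_le/(_ e e0)[N' _ pSN] := pS.
exists (p (maxn N N')); first exact: pfN (leq_maxl N N').
move=> x; rewrite (le_trans (opnorm_ub (opoly (p (maxn N N')) T - xget 0 X) x))//.
rewrite ler_wpM2r ?rnorm_ge0//; have := pSN _ (leq_maxr N N').
by rewrite /= sub0r normrN ger0_norm ?opnorm_ge0.
Qed.

End FunctionalCalculus.

(** * Powers, the absolute value and the mixed Schwarz inequality *)

Section MixedSchwarz.
Context {R : realType} {H : hilbertType R}.
Implicit Types (T S U : bop H) (M C t e s a : R) (p q : {poly R}) (f g h : R -> R).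

Definition positive_op T := posop (opnorm T) T.

Lemma posop_widen M T : positive_op T -> opnorm T <= M -> posop M T.
Proof.
move=> [Tsym T0 TM] TM'; split=> // x.
by rewrite (le_trans (TM x))// ler_wpM2r ?rnorm_ge0.
Qed.

Lemma positive_opP T : self_adjoint T -> (forall x, 0 <= re (hdot (T x) x)) ->
  positive_op T.
Proof. by move=> Tsym T0; split=> //; exact: opnorm_ub. Qed.

Lemma powR_le_bound M s t : 0 <= s -> 0 <= t <= M -> `|t `^ s| <= M `^ s.
Proof.
move=> s0 /andP[t0 tM]; rewrite ger0_norm ?powR_ge0// ge0_ler_powR//.
by rewrite nnegrE (le_trans t0).
Qed.

Lemma powR_sqr s t : 0 <= t -> t `^ s * t `^ s = t `^ (2 * s).
Proof. by move=> t0; rewrite [2 * s]mulrC powRrM powR_mulrn ?powR_ge0// expr2. Qed.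

(** The operator T^s is computed from approximations on any segment containing
    [0, |T|]: an approximation on a larger one restricts to it. *)
Lemma opower_fcalc_widen T M s : positive_op T -> opnorm T <= M -> 0 <= s <= 1 ->
  fcalc M T (fun t => t `^ s) (opower T s).
Proof.
move=> Tpos TM s01; have M0 : 0 <= M by rewrite (le_trans (opnorm_ge0 T)).
have [S fS] := fcalc_exists M0 (posop_widen Tpos TM) (powR_approx M0 s01).
have fS' := fcalc_widen TM fS.
rewrite (fcalc_uniq (opnorm_ge0 T) Tpos (opower_fcalc Tpos (ex_intro _ S fS'))
  fS') //.
Qed.

(** Exponents up to 2 are reached as squares; this also shows that T^(2 s) is
    positive, being the square of a self-adjoint operator. *)
Lemma opower_double T s : positive_op T -> 0 <= s <= 1 ->
  opower T (2 * s) = opower T s * opower T s.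
Proof.
move=> Tpos s01; have [s0 _] := andP s01; have T0 := opnorm_ge0 T.
have fs := opower_fcalc_widen Tpos (lexx _) s01.
have bs t : 0 <= t <= opnorm T -> `|t `^ s| <= opnorm T `^ s := powR_le_bound s0.
have fss := fcalcM T0 Tpos fs fs bs bs.
have f2 : fcalc (opnorm T) T (fun t => t `^ (2 * s)) (opower T s * opower T s).
  move=> e /fss[p pf pS]; exists p => // t tM; rewrite -powR_sqr; first exact: pf.
  by case/andP: tM.
exact: (fcalc_uniq T0 Tpos (opower_fcalc Tpos (ex_intro _ _ f2)) f2).
Qed.

Lemma opower1 T : positive_op T -> opower T 1 = T.
Proof.
move=> Tpos; have T0 := opnorm_ge0 T.
rewrite -[RHS]opolyX; apply: (fcalc_uniq T0 Tpos (opower_fcalc_widen Tpos (lexx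
  _) _) (fcalc_poly _ _ _)).
  by rewrite ler01 lexx.
by move=> t /andP[t0 _]; rewrite hornerX powRr1.
Qed.

Lemma opower_self_adjoint T s : positive_op T -> 0 <= s <= 1 ->
  self_adjoint (opower T s).
Proof.
move=> Tpos s01.
exact: (fcalc_self_adjoint Tpos (opower_fcalc_widen Tpos (lexx _) s01)).
Qed.

Lemma hdot_opower T s x : positive_op T -> 0 <= s <= 1 ->
  hdot (opower T (2 * s) x) x = (rnorm (opower T s x) ^+ 2)%:C.
Proof.
move=> Tpos s01; rewrite opower_double//.
by rewrite -[X in hdot X]/(opower T s (opower T s x)) opower_self_adjoint// hdotxx.
Qed.

Lemma positive_opower T s : positive_op T -> 0 <= s <= 1 ->
  positive_op (opower T (2 * s)).
Proof.
move=> Tpos s01; apply: positive_opP => [x y|x];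
  last by rewrite hdot_opower// reR sqr_ge0.
have sa := opower_self_adjoint Tpos s01.
rewrite opower_double// -[X in hdot X]/(opower T s (opower T s x)).
by rewrite !sa.
Qed.

Lemma positive_adjointM T : positive_op (adjoint T * T).
Proof.
apply: positive_opP => [x y|x].
  by rewrite -[X in hdot X]/(adjoint T (T x)) adjointPl adjointP.
by rewrite -[X in hdot X]/(adjoint T (T x)) adjointPl hdotxx reR sqr_ge0.
Qed.

Let half01 : 0 <= (2^-1 : R) <= 1.
Proof. by apply/andP; split; lra. Qed.

Lemma positive_opabs T : positive_op (opabs T).
Proof.
(* |T| is the square of the fourth root of T* T. *)
rewrite /opabs (_ : 2^-1 = 2 * 4^-1 :> R); last by field.
by apply: positive_opower; [exact: positive_adjointM|lra].
Qed.

Lemma opabs_sqr T : opabs T * opabs T = adjoint T * T.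
Proof.
rewrite /opabs -opower_double ?mulfV//; last exact: positive_adjointM.
by rewrite opower1//; exact: positive_adjointM.
Qed.

Lemma opower_intertwine A B U s : positive_op A -> positive_op B -> 0 <= s <= 1 ->
  U * A = B * U -> U * opower A s = opower B s * U.
Proof.
move=> Apos Bpos s01 UA; pose M := Num.max (opnorm A) (opnorm B).
have [AM BM] : opnorm A <= M /\ opnorm B <= M by rewrite !le_max !lexx orbT.
have M0 : 0 <= M by rewrite (le_trans (opnorm_ge0 A)).
exact: (fcalc_intertwine M0 (posop_widen Apos AM) (posop_widen Bpos BM) UA
  (opower_fcalc_widen Apos AM s01) (opower_fcalc_widen Bpos BM s01)).
Qed.

(** T (T* T) = (T T* ) T passes to the square roots. *)
Lemma opabs_intertwine T : T * opabs T = opabs (adjoint T) * T.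
Proof.
apply: opower_intertwine; [exact: positive_adjointM|exact:
  positive_adjointM|exact: half01|].
by rewrite adjointK mulrA.
Qed.

Lemma rnorm_opabs T x : rnorm (opabs T x) = rnorm (T x).
Proof.
apply/eqP; rewrite -(eqrXn2 (n:=2)) ?rnorm_ge0//; apply/eqP.
apply: (@complexI R); rewrite -!hdotxx (posop_sym (positive_opabs T)).
by rewrite -[X in hdot _ X]/((opabs T * opabs T) x) opabs_sqr /= adjointP.
Qed.

(** For e > 0 let K = (P + e)^-1 and V = T K.  As |T z| = |P z| and
    t / (t + e) <= 1, the operator V is a contraction, and
      T = T K (P + e) = V G F + e V = G' V F + e V,
    so |<T x, y>| <= |F x| |G' y| + e |x| |y|. *)
Lemma factorization_schwarz T P F G G' a x y : positive_op P ->
  (forall z, rnorm (T z) = rnorm (P z)) -> 0 <= a <= 1 ->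
  fcalc (opnorm P) P (fun t => t `^ a) F ->
  fcalc (opnorm P) P (fun t => t `^ (1 - a)) G ->
  T * G = G' * T -> self_adjoint G' ->
  rnorm (hdot (T x) y) <= rnorm (F x) * rnorm (G' y).
Proof.
move=> Ppos TP a01 fF fG TG G'sa.
have b01 : 0 <= 1 - a <= 1 by lra.
have M0 := opnorm_ge0 P; set M := opnorm P in M0 fF fG.
have [a0 _] := andP a01; have [b0 _] := andP b01.
(* One bound for all the functions that enter the products below. *)
pose B e : R := M + 1 + M `^ a + M `^ (1 - a) + e^-1.
have BP (e t : R) : 0 < e -> 0 <= t <= M ->
    [/\ `|t `^ a| <= B e, `|t `^ (1 - a)| <= B e,
      `|(t + e)^-1| <= B e & `|t + e| <= B e + e ].
  move=> e0 tM; have := powR_le_bound a0 tM; have := powR_le_bound b0 tM.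
  have [t0 tM'] := andP tM.
  have i0 : 0 <= e^-1 by rewrite invr_ge0 ltW.
  have te : 0 < t + e by lra.
  have i1 : (t + e)^-1 <= e^-1 by rewrite lef_pV2 ?posrE// lerDr.
  have := powR_ge0 M a; have := powR_ge0 M (1 - a).
  have := invr_ge0 (t + e); rewrite (ltW te) => i2.
  rewrite [`|(t + e)^-1|]ger0_norm// [`|t + e|]ger0_norm ?(ltW te)// /B.
  by move=> *; split; lra.
have GF : G * F = P.
  rewrite -[RHS]opolyX; apply: (fcalc_uniq M0 Ppos (fcalcM M0 Ppos fG fF _ _)
    (fcalc_poly _ _ _)).
  - by move=> t /(BP 1 t ltr01)[_ h _ _]; exact: h.
  - by move=> t /(BP 1 t ltr01)[h _ _ _]; exact: h.
  move=> t /andP[t0 _]; rewrite hornerX -powRD; last first.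
    by rewrite subrK oner_eq0.
  by rewrite subrK powRr1.
rewrite -subr_le0; apply: (@eps_le0 _ _ (rnorm x * rnorm y)).
  by rewrite mulr_ge0 ?rnorm_ge0.
move=> e e0.
have [K fK] := fcalc_exists M0 Ppos (inv_approx M0 e0).
have KG : K * G = G * K.
  apply: (fcalc_uniq M0 Ppos (fcalcM M0 Ppos fK fG _ _) (fcalcM M0 Ppos fG fK _ _)).
  - by move=> t /(BP e t e0)[_ _ h _]; exact: h.
  - by move=> t /(BP e t e0)[_ h _ _]; exact: h.
  - by move=> t /(BP e t e0)[_ h _ _]; exact: h.
  - by move=> t /(BP e t e0)[_ _ h _]; exact: h.
  by move=> t _; rewrite mulrC.
have KE : K * (P + e%:C *: (1 : bop H)) = 1.
  have -> : P + e%:C *: (1 : bop H) = opoly ('X + e%:P) P.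
    by rewrite opolyD opolyX opolyC.
  have -> : 1 = opoly 1 P by rewrite -polyC1 opolyC scale1r.
  apply: (fcalc_uniq M0 Ppos (fcalcM (B := B e + e) M0 Ppos fK (fcalc_poly _ _
    _) _ _) (fcalc_poly _ _ _)).
  - by move=> t /(BP e t e0)[_ _ h _]; rewrite (le_trans h)// lerDl ltW.
  - by move=> t /(BP e t e0)[_ _ _ h]; rewrite hornerD hornerX hornerC.
  move=> t /andP[t0 _]; rewrite hornerD hornerX !hornerC mulVf// gt_eqF//.
  by rewrite ltr_wpDl.
pose V := T * K.
have V1 z : rnorm (V z) <= rnorm z.
  rewrite -[X in rnorm X]/(T (K z)) TP -[leRHS]mul1r.
  have fPK := fcalcM (B := B e + e) M0 Ppos (fcalc_poly M P 'X) fK.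
  rewrite opolyX in fPK; rewrite -[X in rnorm X]/((P * K) z).
  apply: (fcalc_bound M0 Ppos (fPK _ _)).
  - move=> t tM; have [_ _ _] := BP e t e0 tM; rewrite hornerX; apply: le_trans.
    by have /andP[t0 _] := tM; rewrite !ger0_norm ?addr_ge0 ?(ltW e0)// lerDl ltW.
  - by move=> t /(BP e t e0)[_ _ h _]; rewrite (le_trans h)// lerDl ltW.
  move=> t /andP[t0 _]; rewrite hornerX normrM ger0_norm// ger0_norm; last first.
    by rewrite invr_ge0 addr_ge0 ?(ltW e0).
  by rewrite ler_pdivrMr ?ltr_wpDl// mul1r lerDl ltW.
have TE : T = G' * (V * F) + e%:C *: V.
  rewrite -[LHS]mulr1 -KE mulrA -/V mulrDr -bop_scaleAr mulr1 -GF; congr (_ + _).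
  by rewrite /V -!mulrA [K * _]mulrA KG -mulrA mulrA TG -mulrA.
have -> : hdot (T x) y = hdot (V (F x)) (G' y) + e%:C * hdot (V x) y.
  rewrite {1}TE -[X in hdot X]/(G' (V (F x)) + e%:C *: V x) hdotDl hdotZl.
  by rewrite G'sa.
rewrite lerBlDr (le_trans (rnormD _ _))// addrC lerD//.
  rewrite rnormM rnorm_real gtr0_norm// ler_wpM2l ?(ltW e0)//.
  by rewrite (le_trans (hdot_CS _ _))// ler_wpM2r ?rnorm_ge0.
by rewrite (le_trans (hdot_CS _ _))// ler_wpM2r ?rnorm_ge0.
Qed.

Theorem mixed_schwarz T a x y : 0 <= a <= 1 ->
  rnorm (hdot (T x) y) <=
  rnorm (opower (opabs T) a x) * rnorm (opower (opabs (adjoint T)) (1 - a) y).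
Proof.
move=> a01; have b01 : 0 <= 1 - a <= 1 by lra.
have Ppos := positive_opabs T; have Qpos := positive_opabs (adjoint T).
exact: (factorization_schwarz x y Ppos (fun z => esym (rnorm_opabs T z)) a01
  (opower_fcalc_widen Ppos (lexx _) a01) (opower_fcalc_widen Ppos (lexx _) b01)
  (opower_intertwine Ppos Qpos b01 (opabs_intertwine T))
  (opower_self_adjoint Qpos b01)).
Qed.

End MixedSchwarz.

(** * Euclidean norm and Euclidean operator radius *)

Section EuclideanNorm.
Context {R : realType} {d : nat}.
Implicit Types (a b c : 'I_d -> R).

Definition l2 a : R := Num.sqrt (\sum_k a k ^+ 2).

Lemma sum_sqr_ge0 a : 0 <= \sum_k a k ^+ 2.
Proof. by apply: sumr_ge0 => k _; exact: sqr_ge0. Qed.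

Lemma l2_sqr a : l2 a ^+ 2 = \sum_k a k ^+ 2.
Proof. by rewrite sqr_sqrtr ?sum_sqr_ge0. Qed.

Lemma l2_ge0 a : 0 <= l2 a. Proof. exact: sqrtr_ge0. Qed.

Lemma le_l2 a b : (forall k, 0 <= a k <= b k) -> l2 a <= l2 b.
Proof.
move=> ab; rewrite ler_wsqrtr// ler_sum// => k _; have /andP[a0 akb] := ab k.
by rewrite ler_sqr ?nnegrE// (le_trans a0).
Qed.

Lemma sum_mul_le_l2 a b : \sum_k a k * b k <= l2 a * l2 b.
Proof.
have [b0|b0] := eqVneq (l2 b) 0.
  have /eqP : \sum_k b k ^+ 2 = 0 by rewrite -l2_sqr b0 expr0n.
  rewrite psumr_eq0 => [/allP bk0|k _]; last exact: sqr_ge0.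
  rewrite b0 mulr0 big1// => k _.
  by have := bk0 k (mem_index_enum k); rewrite sqrf_eq0 => /eqP->; rewrite mulr0.
have {}b0 : 0 < l2 b by rewrite lt_def b0 l2_ge0.
have : 0 <= \sum_k (l2 b * a k - l2 a * b k) ^+ 2 by exact: sum_sqr_ge0.
have -> : \sum_k (l2 b * a k - l2 a * b k) ^+ 2 =
    l2 b ^+ 2 * l2 a ^+ 2 - 2 * l2 a * l2 b * \sum_k (a k * b k) + l2 a ^+ 2 *
      l2 b ^+ 2.
  rewrite [in X in X - _](l2_sqr a) [in X in _ + X](l2_sqr b) !mulr_sumr -sumrB
    -big_split.
  by apply: eq_bigr => k _ /=; ring.
have [a0|a0] := eqVneq (l2 a) 0.
  have /eqP : \sum_k a k ^+ 2 = 0 by rewrite -l2_sqr a0 expr0n.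
  rewrite psumr_eq0 => [/allP ak0|k _]; last exact: sqr_ge0.
  rewrite a0 mul0r big1// => k _.
  by have := ak0 k (mem_index_enum k); rewrite sqrf_eq0 => /eqP->; rewrite mul0r.
have {}a0 : 0 < l2 a by rewrite lt_def a0 l2_ge0.
move=> h; rewrite -(ler_pM2l (mulr_gt0 a0 b0)); lra.
Qed.

(** The triangle inequality, from |c|^2 <= sum of the <c, e i> and the
    Cauchy-Schwarz inequality. *)
Lemma l2_le_sum (I : Type) (r : seq I) (P : pred I) c (e : I -> 'I_d -> R) :
  (forall k, 0 <= c k <= \sum_(i <- r | P i) e i k) ->
  l2 c <= \sum_(i <- r | P i) l2 (e i).
Proof.
move=> ce; have [->|c0] := eqVneq (l2 c) 0; first by rewrite sumr_ge0// => i _;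
  exact: l2_ge0.
have {}c0 : 0 < l2 c by rewrite lt_def c0 l2_ge0.
rewrite -(ler_pM2l c0) -expr2 l2_sqr mulr_sumr.
apply: (@le_trans _ _ (\sum_k \sum_(i <- r | P i) c k * e i k)).
  apply: ler_sum => k _; rewrite -mulr_sumr expr2; have /andP[? ?] := ce k.
  by rewrite ler_wpM2l.
by rewrite exchange_big /= ler_sum// => i _; exact: sum_mul_le_l2.
Qed.

End EuclideanNorm.

Lemma sup_nneg {R : realType} (E : set R) : (forall x, E x -> 0 <= x) -> 0 <= sup E.
Proof.
move=> E0; have [[[x Ex] ubE]|/sup_out->//] := pselect (has_sup E).
exact: le_trans (E0 x Ex) (ub_le_sup ubE Ex).
Qed.

Section EuclideanRadius.
Context {R : realType} {H : hilbertType R} {d : nat}.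
Implicit Types (T S : 'I_d -> bop H) (x y : H).

Local Notation we := euclidean_radius.

Lemma we_has_ub T : has_ubound [set Num.sqrt (\sum_(k < d) rnorm (hdot (T k x)
  x) ^+ 2)
      | x in [set x : H | `|x| = 1]].
Proof.
exists (l2 (fun k => opnorm (T k))) => _ [x x1 <-]; apply: le_l2 => k.
rewrite rnorm_ge0 (le_trans (hdot_CS _ _))//.
have {}x1 : rnorm x = 1 by apply: (@complexI R); rewrite -rnormE.
by have := opnorm_ub (T k) x; rewrite x1 !mulr1.
Qed.

Lemma we_ge0 T : 0 <= we T.
Proof. by apply: sup_nneg => _ [x _ <-]; exact: sqrtr_ge0. Qed.

(** Homogeneity extends the defining bound from unit vectors to all vectors. *)
Lemma we_ub T x : l2 (fun k => rnorm (hdot (T k x) x)) <= we T * rnorm x ^+ 2.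
Proof.
have [->|x0] := eqVneq x 0.
  rewrite rnorm0 expr0n mulr0 /l2 big1 ?sqrtr0// => k _.
  by rewrite hdot0r rnorm0 expr0n.
have {}x0 : 0 < rnorm x by rewrite lt_def rnorm_eq0 x0 rnorm_ge0.
pose u := (rnorm x)^-1%:C *: x.
have u1 : `|u| = 1.
  by rewrite rnormE rnormZ rnorm_real ger0_norm ?invr_ge0 ?rnorm_ge0// mulVf// gt_eqF.
have := ub_le_sup (we_has_ub T) (ex_intro2 _ _ u u1 erefl).
rewrite -/(we T) -(ler_pM2r (exprn_gt0 2 x0)); apply: le_trans.
rewrite -(ler_sqr (x := l2 _)) ?nnegrE ?mulr_ge0 ?sqr_ge0 ?l2_ge0 ?rnorm_ge0//.
rewrite exprMn !l2_sqr mulr_suml ler_sum// => k _.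
have Tu : T k u = (rnorm x)^-1%:C *: T k x by rewrite linearZ.
rewrite Tu hdotZl hdotZr conjc_realE !rnormM !rnorm_real.
rewrite ger0_norm ?invr_ge0 ?(ltW x0)// le_eqVlt; apply/orP; left; apply/eqP.
by field; rewrite gt_eqF.
Qed.

Definition alpha_sum (a : R) T S : 'I_d -> bop H :=
  tadd (tpower (tabs T) (2 * a)) (tpower (tabs (tadjoint S)) (2 * (1 - a))).

Lemma alpha_sum_half T S : alpha_sum 2^-1 T S = tadd (tabs T) (tabs (tadjoint S)).
Proof.
have h1 : 2 * 2^-1 = 1 :> R by rewrite mulfV.
have h2 : 2 * (1 - 2^-1) = 1 :> R by field.
apply/funext => k; rewrite /alpha_sum h1 h2 /tadd /tpower.
exact: (congr2 +%R (opower1 (positive_opabs (T k)))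
  (opower1 (positive_opabs (adjoint (S k))))).
Qed.

Lemma rnorm_hdotD (u v x : H) (r s : R) : 0 <= r -> 0 <= s ->
  hdot u x = r%:C -> hdot v x = s%:C -> rnorm (hdot (u + v) x) = r + s.
Proof.
by move=> r0 s0 ur vs; rewrite hdotDl ur vs -rmorphD rnorm_real ger0_norm ?addr_ge0.
Qed.

Lemma rnorm_alpha_sum (a : R) T S x k : 0 <= a <= 1 ->
  rnorm (hdot (alpha_sum a T S k x) x) =
  rnorm (opower (opabs (T k)) a x) ^+ 2
  + rnorm (opower (opabs (adjoint (S k))) (1 - a) x) ^+ 2.
Proof.
move=> a01; have b01 : 0 <= 1 - a <= 1 by lra.
apply: (@rnorm_hdotD (opower (opabs (T k)) (2 * a) x)
  (opower (opabs (adjoint (S k))) (2 * (1 - a)) x) x _ _ (sqr_ge0 _) (sqr_ge0 _)).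
  exact: hdot_opower (positive_opabs _) a01.
exact: hdot_opower (positive_opabs _) b01.
Qed.

Lemma sqr_add_le (m1 m2 r1 r2 r3 r4 : R) : 0 <= m1 -> 0 <= m2 ->
  m1 <= r1 * r2 -> m2 <= r3 * r4 ->
  (m1 + m2) ^+ 2 <= (r3 ^+ 2 + r2 ^+ 2) * (r1 ^+ 2 + r4 ^+ 2).
Proof.
move=> m10 m20 h1 h2; apply: (@le_trans _ _ ((r1 * r2 + r3 * r4) ^+ 2)).
  by rewrite ler_sqr ?nnegrE; lra.
by have := sqr_ge0 (r1 * r3 - r2 * r4); lra.
Qed.

Lemma sqr_sqrtM (p q r s : R) : 0 <= p -> 0 <= q ->
  (Num.sqrt p * Num.sqrt q * (r * s)) ^+ 2 = p * r ^+ 2 * (q * s ^+ 2).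
Proof. by move=> p0 q0; rewrite !exprMn !sqr_sqrtr// mulrACA. Qed.

(** For each k, mixed Schwarz bounds the two terms by r1 r2 and r3 r4, and
    (r1 r2 + r3 r4)^2 <= (r3^2 + r2^2) (r1^2 + r4^2) groups the factors in x and
    those in y, which are the forms of the two tuples of the statement. *)
Lemma offdiag_le (a : R) T S x y : 0 <= a <= 1 ->
  l2 (fun k => rnorm (hdot (T k y) x) + rnorm (hdot (S k x) y)) <=
  Num.sqrt (we (alpha_sum a S T)) * Num.sqrt (we (alpha_sum a T S))
  * (rnorm x * rnorm y).
Proof.
move=> a01.
pose u k := rnorm (hdot (alpha_sum a S T k x) x).
pose v k := rnorm (hdot (alpha_sum a T S k y) y).
rewrite -ler_sqr ?nnegrE ?l2_ge0 ?mulr_ge0 ?sqrtr_ge0 ?rnorm_ge0// l2_sqr.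
apply: (@le_trans _ _ (\sum_k u k * v k)).
  apply: ler_sum => k _.
  rewrite /u /v (rnorm_alpha_sum S T x k a01) (rnorm_alpha_sum T S y k a01).
  exact: (sqr_add_le (rnorm_ge0 _) (rnorm_ge0 _) (mixed_schwarz (T k) y x a01)
    (mixed_schwarz (S k) x y a01)).
rewrite (le_trans (sum_mul_le_l2 u v))//.
rewrite (le_trans (ler_pM (l2_ge0 u) (l2_ge0 v) (we_ub _ x) (we_ub _ y)))//.
by rewrite (sqr_sqrtM _ _ (we_ge0 _) (we_ge0 _)) lexx.
Qed.

Lemma offdiag_half_le T S x y :
  l2 (fun k => rnorm (hdot (T k y) x) + rnorm (hdot (S k x) y)) <=
  Num.sqrt (we (tadd (tabs S) (tabs (tadjoint T)))
            * we (tadd (tabs T) (tabs (tadjoint S)))) * (rnorm x * rnorm y).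
Proof.
have half01 : 0 <= (2^-1 : R) <= 1 by apply/andP; split; lra.
have := offdiag_le T S x y half01.
by rewrite (alpha_sum_half S T) (alpha_sum_half T S) (sqrtrM _ (we_ge0 _)).
Qed.

End EuclideanRadius.

(** * Numerical radius and operator matrices *)

Section NumericalRadius.
Context {R : realType} {n : nat}.
Implicit Types (b : 'I_n -> 'I_n -> R) (y : 'I_n -> R).

Lemma unit_entry_le1 (z : 'cV[R[i]]_n) i :
  \sum_i rnorm (z i 0) ^+ 2 = 1 -> rnorm (z i 0) <= 1.
Proof.
move=> z1; rewrite -(@expr_le1 _ 2) ?rnorm_ge0//
  -z1 (bigD1 i)//= lerDl sumr_ge0// => j _.
exact: sqr_ge0.
Qed.

Lemma numerical_radius_has_ub (M : 'M[R[i]]_n) :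
  has_ubound [set rnorm (\sum_i (M *m x) i 0 * Num.conj (x i 0))
      | x in [set x : 'cV[R[i]]_n | \sum_i rnorm (x i 0) ^+ 2 = 1]].
Proof.
exists (\sum_i \sum_j rnorm (M i j)) => _ [z z1 <-].
rewrite (le_trans (rnorm_sum _ _ _))// ler_sum// => i _.
rewrite rnormM rnormC (@le_trans _ _ (rnorm ((M *m z) i 0)))//.
  by rewrite ler_piMr ?rnorm_ge0 ?unit_entry_le1.
rewrite mxE (le_trans (rnorm_sum _ _ _))// ler_sum// => j _.
by rewrite rnormM ler_piMr ?rnorm_ge0 ?unit_entry_le1.
Qed.

Lemma numerical_radius_ge0 (M : 'M[R[i]]_n) : 0 <= numerical_radius M.
Proof. by apply: sup_nneg => _ [z _ <-]; exact: rnorm_ge0. Qed.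

Lemma quadratic_le_numerical_radius b y : \sum_i y i ^+ 2 = 1 ->
  \sum_i \sum_j b i j * (y i * y j)
  <= numerical_radius (\matrix_(i < n, j < n) (b i j)%:C).
Proof.
move=> y1; pose z : 'cV[R[i]]_n := \col_i (y i)%:C.
have z1 : \sum_i rnorm (z i 0) ^+ 2 = 1.
  by rewrite -y1; apply: eq_bigr => i _; rewrite mxE rnorm_real real_normK ?num_real.
apply: le_trans (ub_le_sup (numerical_radius_has_ub _) (ex_intro2 _ _ z z1 erefl)).
set s := \sum_i \sum_j _; rewrite (_ : \sum_i _ = s%:C);
  first by rewrite rnorm_real ler_norm.
rewrite /s rmorph_sum; apply: eq_bigr => i _; rewrite !mxE mulr_suml rmorph_sum.
apply: eq_bigr => j _; rewrite !mxE conjc_realE !rmorphM /=.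
by rewrite -!mulrA; congr (_ * _); rewrite mulrC.
Qed.

End NumericalRadius.

Section OperatorMatrices.
Context {R : realType} {H : hilbertType R} {d n : nat}.

(** Exchanging the two indices folds the strictly lower triangle onto the upper
    one; this is why [b_ij] can be taken upper triangular. *)
Lemma sum_fold_upper (a : 'I_n -> 'I_n -> R) :
  \sum_i \sum_j a i j = \sum_i \sum_j
    (if i == j then a i j else if (i < j)%N then a i j + a j i else 0).
Proof.
pose D := \sum_i \sum_j (if i == j then a i j else 0).
pose U := \sum_(i < n) \sum_(j < n) (if (i < j)%N then a i j else 0).
pose L := \sum_(i < n) \sum_(j < n) (if (j < i)%N then a i j else 0).
have -> : \sum_i \sum_j a i j = D + U + L.
  rewrite -!big_split; apply: eq_bigr => i _; rewrite -!big_split;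
    apply: eq_bigr => j _ /=.
  by rewrite -val_eqE /=; case: ltngtP => _; rewrite ?addr0 ?add0r.
rewrite /L exchange_big -!big_split; apply: eq_bigr => i _; rewrite -!big_split.
apply: eq_bigr => j _ /=.
by rewrite -val_eqE /=; case: ltngtP => _; rewrite ?addr0 ?add0r.
Qed.

Lemma hdot_opmx (B : 'M[bop H]_n) (x : hsum H n) :
  hdot (opmx B x) x = \sum_i \sum_j hdot (B i j (x j)) (x i).
Proof.
rewrite -[LHS]/(\sum_i hdot (opmx B x i) (x i)); apply: eq_bigr => i _.
rewrite ffunE; apply: (big_morph (fun z => hdot z (x i))) => [u v|];
  first exact: hdotDl.
exact: hdot0l.
Qed.

(** The off-diagonal entries enter only through a bound c on the contribution of
    a pair i < j, so that both choices of entries are instances. *)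
Lemma euclidean_radius_topmx_le (A : 'M['I_d -> bop H]_n) (c : 'I_n -> 'I_n -> R) :
  (forall i j, 0 <= c i j) ->
  (forall (i j : 'I_n) x y, (i < j)%N ->
    l2 (fun k => rnorm (hdot (A i j k y) x) + rnorm (hdot (A j i k x) y))
      <= c i j * (rnorm x * rnorm y)) ->
  euclidean_radius (topmx A) <= numerical_radius (\matrix_(i < n, j < n)
    (if i == j then euclidean_radius (A i j)
     else if (i < j)%N then c i j else 0)%:C).
Proof.
move=> c0 Ac; set b := fun i j : 'I_n => if i == j then euclidean_radius (A i j)
     else if (i < j)%N then c i j else 0.
rewrite /euclidean_radius; set E := (X in sup X).
(* When H = 0 there is no unit vector and the supremum is 0. *)
have [[E0 _]|/sup_out->] := pselect (has_sup E); last exact: numerical_radius_ge0.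
apply: ge_sup E0 _ => _ [x x1 <-].
have y1 : \sum_i rnorm (x i) ^+ 2 = 1.
  apply: (@complexI R); rewrite rmorph_sum /=.
  transitivity (`|x| ^+ 2); last by rewrite x1 expr1n.
  rewrite hsum_normE hsum_norm_sqr.
  by apply: eq_bigr => i _; rewrite rnormE rmorphXn.
apply: le_trans (quadratic_le_numerical_radius b y1).
pose e (i j : 'I_n) k : R := if i == j then rnorm (hdot (A i j k (x j)) (x i))
  else if (i < j)%N then
    rnorm (hdot (A i j k (x j)) (x i)) + rnorm (hdot (A j i k (x i)) (x j))
  else 0.
have e0 i j k : 0 <= e i j k.
  by rewrite /e; do 2?case: ifP => _; rewrite ?addr_ge0 ?rnorm_ge0.
apply: (@le_trans _ _ (\sum_i \sum_j l2 (e i j))).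
  apply: (@le_trans _ _ (\sum_i l2 (fun k => \sum_j e i j k))); last first.
    apply: ler_sum => i _; apply: l2_le_sum => k; rewrite lexx andbT.
    by apply: sumr_ge0 => j _; exact: e0.
  apply: l2_le_sum => k; rewrite rnorm_ge0 hdot_opmx /=.
  rewrite (le_trans (rnorm_sum _ _ _))//.
  apply: (@le_trans _ _ (\sum_i \sum_j rnorm (hdot (A i j k (x j)) (x i)))).
    apply: ler_sum => i _; rewrite (le_trans (rnorm_sum _ _ _))// ler_sum// => j _.
    by rewrite mxE.
  by rewrite sum_fold_upper.
apply: ler_sum => i _; apply: ler_sum => j _; rewrite /e /b.
case: eqVneq => [<-|ij]; first exact: we_ub.
case: ifP => [lij|_]; first exact: Ac.
by rewrite mul0r /l2 big1 ?sqrtr0// => k _; rewrite expr0n.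
Qed.

End OperatorMatrices.

Theorem corollary3p2 (R : realType) (H : hilbertType R) (d n : nat)
    (hd : (1 <= d)%N) (hn : (1 <= n)%N) (A : 'M['I_d -> bop H]_n) :
  (forall alpha : R, 0 <= alpha <= 1 ->
    euclidean_radius (topmx A) <= numerical_radius (\matrix_(i < n, j < n)
      (if i == j then euclidean_radius (A i j)
       else if (i < j)%N then
         Num.sqrt (euclidean_radius
           (tadd (tpower (tabs (A j i)) (2 * alpha))
                 (tpower (tabs (tadjoint (A i j))) (2 * (1 - alpha)))))
         * Num.sqrt (euclidean_radius
           (tadd (tpower (tabs (A i j)) (2 * alpha))
                 (tpower (tabs (tadjoint (A j i))) (2 * (1 - alpha)))))
       else 0)%:C)) /\
  euclidean_radius (topmx A) <= numerical_radius (\matrix_(i < n, j < n)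
    (if i == j then euclidean_radius (A i j)
     else if (i < j)%N then
       Num.sqrt (euclidean_radius (tadd (tabs (A j i)) (tabs (tadjoint (A i j))))
               * euclidean_radius (tadd (tabs (A i j)) (tabs (tadjoint (A j i)))))
     else 0)%:C).
Proof.
split=> [a a01|].
  apply: (euclidean_radius_topmx_le (c := fun i j =>
      Num.sqrt (euclidean_radius (alpha_sum a (A j i) (A i j)))
      * Num.sqrt (euclidean_radius (alpha_sum a (A i j) (A j i)))))
    => [i j|i j x y _].
    by rewrite mulr_ge0 ?sqrtr_ge0.
  exact: offdiag_le.
apply: (euclidean_radius_topmx_le (c := fun i j => Num.sqrt
    (euclidean_radius (tadd (tabs (A j i)) (tabs (tadjoint (A i j)))) *
     euclidean_radius (tadd (tabs (A i j)) (tabs (tadjoint (A j i)))))))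
  => [i j|i j x y _].
  exact: sqrtr_ge0.
exact: offdiag_half_le.
Qed.
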